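(* Let $w$ be an even positive integer. Then $$\{\,S_{w,4i\pm1}(h,k)\ |\ i=1,2,\ldots,d_w\,\}\cup\{\,h^w-k^w\,\}$$ form a basis for the complex vector space $\mathcal U_w^+$.
   Context: $\mathcal U_w$ is the space of homogeneous polynomials $g$ (complex coefficients) in $h$ and $k$ of degree $w$ satisfying $g(h+k,k)+g(h,h+k)=g(h,k)$ and $g(1,1)=0$. $\mathcal U_w^+$ is the subspace of those $g\in\mathcal U_w$ which are even, i.e. $g(h,-k)=g(h,k)$. The integer $d_w$ is defined by $d_w=\lfloor\frac{w+2}{12}\rfloor-1$ if $w\equiv 0\pmod{12}$ and $d_w=\lfloor\frac{w+2}{12}\rfloor$ otherwise. Convention: for $1\le i\le d_w$, the symbol $4i\pm1$ means $4i+1$ if $w\equiv0\pmod4$, and $4i-1$ if $w\equiv2\pmod 4$. $B_m(x)$ is the $m$th Bernoulli polynomial, $\frac{te^{xt}}{e^t-1}=\sum_{m\ge0}B_m(x)\frac{t^m}{m!}$, and $B_m=B_m(0)$. For an integer $n$ with $0<n<w$ put $\tilde n=w-n$ and $$S_{w,n}(h,k)=(-1)^n\frac{B_{n+1}(\frac kh)h^w}{n+1}+\frac{B_{n+1}(\frac hk)k^w}{n+1}-\frac{B_{\tilde n+1}(\frac kh)h^w}{\tilde n+1}-(-1)^n\frac{B_{\tilde n+1}(\frac hk)k^w}{\tilde n+1}+\epsilon_n(h,k),$$ where $\epsilon_n(h,k)=\frac{w+2}{B_{w+2}}\frac{B_{n+1}}{n+1}\frac{B_{\tilde n+1}}{\tilde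 n+1}(h^w-k^w)$ if $n$ is odd and $\epsilon_n=0$ if $n$ is even. *)

(* Defs.v *)
From HB Require Import structures.
From mathcomp Require Import all_boot all_order all_algebra.
From mathcomp Require Import mpoly.

Set Implicit Arguments.
Unset Strict Implicit.
Unset Printing Implicit Defensive.

Import GRing.Theory Num.Theory.
Local Open Scope ring_scope.

(* A formal power series sum_n a_n t^n is represented by its coefficient
   sequence a : nat -> A. *)
Section PowerSeries.
Variable A : comNzRingType.
Implicit Types a b c : nat -> A.

Definition fps_mul a b (n : nat) : A := \sum_(k < n.+1) a k * b (n - k)%N.

Lemma fps_mul_coef a b n N : (n <= N)%N ->
  fps_mul a b n = ((\poly_(i < N.+1) a i) * (\poly_(i < N.+1) b i))`_n.
Proof.
move=> leN; rewrite coefM; apply: eq_bigr => k _.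
rewrite !coef_poly !ltnS (leq_trans (leq_subr _ _) leN).
by rewrite (leq_trans _ leN) // -ltnS.
Qed.

Lemma fps_mulC a b n : fps_mul a b n = fps_mul b a n.
Proof. by rewrite !(@fps_mul_coef _ _ n n) // mulrC. Qed.

Lemma fps_mulA a b c n :
  fps_mul a (fps_mul b c) n = fps_mul (fps_mul a b) c n.
Proof.
pose P (d : nat -> A) := \poly_(i < n.+1) d i.
transitivity ((P a * (P b * P c))`_n).
  rewrite coefM; apply: eq_bigr => k _; rewrite coef_poly ltn_ord.
  by rewrite (@fps_mul_coef _ _ _ n) // leq_subr.
rewrite mulrA coefM; apply: eq_bigr => k _.
rewrite [(P c)`__]coef_poly ltnS leq_subr.
by rewrite (@fps_mul_coef _ _ _ n) // -ltnS.
Qed.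

End PowerSeries.

Section Bernoulli.
Variable K : numFieldType.

(* The first n coefficients of the inverse of a power series with a_0 <> 0. *)
Fixpoint fps_inv_seq (a : nat -> K) (n : nat) : seq K :=
  if n is m.+1 then
    let s := fps_inv_seq a m in
    rcons s (((m == 0)%:R - \sum_(k < m) s`_k * a (m - k)%N) / a 0%N)
  else [::].

Definition fps_inv (a : nat -> K) (n : nat) : K := (fps_inv_seq a n.+1)`_n.

Lemma size_fps_inv_seq a n : size (fps_inv_seq a n) = n.
Proof. by elim: n => //= n IHn; rewrite size_rcons IHn. Qed.

Lemma nth_fps_inv_seq a n k : (k < n)%N -> (fps_inv_seq a n)`_k = fps_inv a k.
Proof.
elim: n => // n IHn; rewrite ltnS leq_eqVlt => /orP[/eqP-> //|ltkn].
by rewrite /= nth_rcons size_fps_inv_seq ltkn IHn.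
Qed.

Lemma fps_invP a n : a 0%N != 0 -> fps_mul (fps_inv a) a n = (n == 0)%:R.
Proof.
move=> a0; rewrite /fps_mul big_ord_recr /= subnn {2}/fps_inv /=.
rewrite nth_rcons size_fps_inv_seq ltnn eqxx divfK //.
rewrite addrC -[RHS](subrK (\sum_(k < n) (fps_inv_seq a n)`_k * a (n - k)%N)).
by congr (_ + _); apply: eq_bigr => k _; rewrite nth_fps_inv_seq.
Qed.

(* t e^(xt) / (e^t - 1) = ((e^t - 1) / t)^-1 * e^(xt), and B_m(x) is m! times
   the coefficient of t^m. *)
Definition bernoulli_poly (m : nat) : {poly K} :=
  m`!%:R *: fps_mul
    (fun i => (fps_inv (fun j => (j.+1)`!%:R^-1) i)%:P)
    (fun i => (i`!%:R^-1) *: 'X^i) m.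

Definition bernoulli (m : nat) : K := (bernoulli_poly m).[0].

Lemma natf_fact_neq0 n : n`!%:R != 0 :> K.
Proof. by rewrite pnatr_eq0 -lt0n fact_gt0. Qed.

(* (e^t - 1) * sum_m B_m(x) t^m / m! = t e^(xt) *)
Lemma bernoulli_poly_gen n :
  fps_mul (fun i => ((0 < i)%:R / i`!%:R)%:P)
          (fun m => m`!%:R^-1 *: bernoulli_poly m) n
  = if n is m.+1 then m`!%:R^-1 *: 'X^m else 0.
Proof.
rewrite /fps_mul big_ord_recl /= mul0r polyC0 mul0r add0r.
case: n => [|n]; first by rewrite big_ord0.
pose a j : K := (j.+1)`!%:R^-1.
pose E i : {poly K} := (i`!%:R^-1) *: 'X^i.
transitivity (fps_mul (fun i => (a i)%:P)
                (fps_mul (fun i => (fps_inv a i)%:P) E) n).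
  apply: eq_bigr => k _; rewrite /bump /= add1n subSS mul1r.
  by rewrite scalerA mulVf ?natf_fact_neq0 // scale1r.
have delta m : fps_mul (fun i => (a i)%:P) (fun i => (fps_inv a i)%:P) m
               = (m == 0)%:R.
  rewrite fps_mulC -[RHS](rmorph_nat (@polyC K)) -(@fps_invP a); last first.
    by rewrite invr_eq0 natf_fact_neq0.
  by rewrite /fps_mul rmorph_sum; apply: eq_bigr => i _; rewrite /= polyCM.
rewrite fps_mulA [LHS]big_ord_recl delta mul1r subn0 big1 ?addr0 // => k _.
by rewrite delta mul0r.
Qed.

Lemma size_bernoulli_poly m : (size (bernoulli_poly m) <= m.+1)%N.
Proof.
rewrite (leq_trans (size_scale_leq _ _)) // (leq_trans (size_sum _ _ _)) //.
apply/bigmax_leqP => k _; rewrite mul_polyC.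
rewrite !(leq_trans (size_scale_leq _ _)) // size_polyXn ltnS leq_subr.
by [].
Qed.

End Bernoulli.

Section BinaryForms.
Variable K : numFieldType.

(* dhomog 2 K w is the finite-dimensional space of homogeneous polynomials of
   degree w in two variables, including 0. *)
Local Notation form := (dhomog 2 K).

Lemma var_homog (i : 'I_2) : ('X_i : {mpoly K[2]}) \is 1.-homog.
Proof. by rewrite dhomogX; apply/eqP; exact: mdeg1. Qed.

Definition vh : form 1 := DHomog (var_homog ord0).
Definition vk : form 1 := DHomog (var_homog ord_max).

Lemma formX_homog (l : form 1) w : (l : {mpoly K[2]}) ^+ w \is w.-homog.
Proof. by rewrite -[X in X.-homog]mul1n dhomogMn // dhomog_is_dhomog. Qed.

Lemma subst_homog (l1 l2 : form 1) w (g : form w) :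
  (val g \mPo [tuple val l1; val l2]) \is w.-homog.
Proof.
rewrite comp_mpolyE big_seq rpred_sum // => m m_g; apply: rpredZ.
have <- : mdeg m = w by apply: (dhomogP _ _ _ (dhomog_is_dhomog g)).
rewrite mdegE !big_ord_recl !big_ord0 /= addn0 mulr1.
by apply: dhomogM; rewrite ?(tnth_nth 0) /=; exact: formX_homog.
Qed.

(* g(l1, l2) for linear forms l1 and l2 *)
Definition subst (l1 l2 : form 1) w (g : form w) : form w :=
  DHomog (subst_homog l1 l2 g).

Lemma subst_is_linear l1 l2 w : linear (@subst l1 l2 w).
Proof. by move=> a f g; apply: val_inj; rewrite /= linearP. Qed.

HB.instance Definition _ l1 l2 w :=
  GRing.isLinear.Build K (form w) (form w) _ (@subst l1 l2 w)
    (subst_is_linear l1 l2 (w := w)).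

Definition eval11 w (g : form w) : K^o := (val g).@[fun => 1].

Lemma eval11_is_linear w : linear (@eval11 w).
Proof. by move=> a f g; rewrite /eval11 /= mevalD mevalZ. Qed.

HB.instance Definition _ w :=
  GRing.isLinear.Build K (form w) K^o _ (@eval11 w) (@eval11_is_linear w).

Definition U (w : nat) : {vspace form w} :=
  let f := linfun (@subst (vh + vk) vk w) + linfun (@subst vh (vh + vk) w) in
  (lker (f - \1%VF) :&: lker (linfun (@eval11 w)))%VS.

Definition Uplus (w : nat) : {vspace form w} :=
  let f := linfun (@subst vh (- vk) w) in (U w :&: lker (f - \1%VF))%VS.

Local Notation h := ('X_ord0 : {mpoly K[2]}).
Local Notation k := ('X_ord_max : {mpoly K[2]}).

Lemma mem_U w (g : form w) :
  reflect
    ((val g \mPo [tuple h + k; k]) + (val g \mPo [tuple h; h + k]) = val g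
     /\ (val g).@[fun => 1] = 0)
    (g \in U w).
Proof.
rewrite memv_cap !memv_ker !add_lfunE opp_lfunE id_lfunE !lfunE subr_eq0.
by apply: (iffP andP) => [[/eqP/(congr1 val) /= ? /eqP ?]|[? ?]]; split=> //;
  apply/eqP; [apply: val_inj|].
Qed.

Lemma mem_Uplus w (g : form w) :
  reflect (g \in U w /\ (val g \mPo [tuple h; - k]) = val g) (g \in Uplus w).
Proof.
rewrite [g \in Uplus w]memv_cap; set u := g \in U w.
rewrite memv_ker !add_lfunE opp_lfunE id_lfunE lfunE subr_eq0.
by apply: (iffP andP) => [[-> /eqP/(congr1 val) /= ?]|[-> ?]]; split=> //;
  apply/eqP/val_inj.
Qed.

(* The polynomial p(b/a) a^w, for p of degree at most w; in particular
   B_m(b/a) a^w for m <= w. *)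
Definition homogenize (w : nat) (p : {poly K}) (a b : {mpoly K[2]}) :
    {mpoly K[2]} :=
  \sum_(j < w.+1) p`_j *: (a ^+ (w - j) * b ^+ j).

Lemma homogenizeE w (p : {poly K}) (a b : {mpoly K[2]}) (v : 'I_2 -> K) :
  (size p <= w.+1)%N -> a.@[v] != 0 ->
  (homogenize w p a b).@[v] = p.[b.@[v] / a.@[v]] * a.@[v] ^+ w.
Proof.
move=> lepw a0; rewrite (horner_coef_wide _ lepw) mulr_suml raddf_sum.
apply: eq_bigr => j _ /=; rewrite mevalZ mevalM !rmorphXn /= -mulrA.
congr (_ * _); have lejw : (j <= w)%N by rewrite -ltnS.
have -> : a.@[v] ^+ w = a.@[v] ^+ (w - j) * a.@[v] ^+ j.
  by rewrite -exprD subnK.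
by rewrite expr_div_n [RHS]mulrCA divfK ?expf_neq0.
Qed.

Lemma homogenize_homog w p (a b : form 1) :
  homogenize w p (val a) (val b) \is w.-homog.
Proof.
apply: rpred_sum => j _; apply: rpredZ.
have lejw : (j <= w)%N by rewrite -ltnS.
by have := dhomogM (formX_homog a (w - j)) (formX_homog b j); rewrite subnK.
Qed.

Local Notation B := (bernoulli_poly K).
Local Notation Bn := (bernoulli K).

Definition eps (w n : nat) : {mpoly K[2]} :=
  if odd n then
    (w.+2%:R / Bn w.+2 * (Bn n.+1 / n.+1%:R)
       * (Bn (w - n).+1 / (w - n).+1%:R)) *: (h ^+ w - k ^+ w)
  else 0.

(* S_{w,n}(h,k), for 0 < n < w: then n + 1 and w - n + 1 are at most w, so no
   Bernoulli polynomial is truncated by homogenize. *)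
Definition Spoly (w n : nat) : {mpoly K[2]} :=
  let n' := (w - n)%N in
    ((-1) ^+ n / n.+1%:R) *: homogenize w (B n.+1) h k
  + n.+1%:R^-1 *: homogenize w (B n.+1) k h
  - n'.+1%:R^-1 *: homogenize w (B n'.+1) h k
  - ((-1) ^+ n / n'.+1%:R) *: homogenize w (B n'.+1) k h
  + eps w n.

Lemma diff_homog w : h ^+ w - k ^+ w \is w.-homog.
Proof. by rewrite rpredB // (formX_homog vh, formX_homog vk). Qed.

Lemma Spoly_homog w n : Spoly w n \is w.-homog.
Proof.
have Hhk p : homogenize w p h k \is w.-homog := homogenize_homog w p vh vk.
have Hkh p : homogenize w p k h \is w.-homog := homogenize_homog w p vk vh.
apply: rpredD; last first.
  by rewrite /eps; case: ifP => _; [exact/rpredZ/diff_homog | exact: rpred0].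
apply: rpredB; last by apply: rpredZ; exact: Hkh.
apply: rpredB; last by apply: rpredZ; exact: Hhk.
by apply: rpredD; apply: rpredZ; [exact: Hhk | exact: Hkh].
Qed.

Definition Sform (w n : nat) : form w := DHomog (Spoly_homog w n).
Definition hw_sub_kw (w : nat) : form w := DHomog (diff_homog w).

End BinaryForms.

Definition d_ (w : nat) : nat :=
  if (12 %| w)%N then ((w + 2) %/ 12 - 1)%N else ((w + 2) %/ 12)%N.

(* 4i + 1 if w = 0 mod 4, 4i - 1 if w = 2 mod 4 (w is even, i >= 1) *)
Definition four_pm1 (w i : nat) : nat :=
  if (4 %| w)%N then (4 * i + 1)%N else (4 * i - 1)%N.

(* Main.v *)
Require Import Defs.
From mathcomp Require Import all_boot all_order all_algebra.
From mathcomp Require Import perm zify ring.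
From mathcomp Require Import reals complex mpoly.

(** Write m = w/2 and let z = - x - y, so that S3 permutes x, y, z.

    Substituting (h + k, - k) in the three-term relation shows that an even
    solution g is antisymmetric, and the relation then reads
      g(x, y) + g(y, z) + g(z, x) = 0.
    So the space of even period polynomials is the kernel of the
    S3-antisymmetrizer on the even antisymmetric forms of degree w.

    Membership.  For n odd put F = B_(n+1)/(n+1) + B_(w-n+1)/(w-n+1).  Then
    F(x + 1) - F(x) = x^n + x^(w-n) is odd and palindromic, hence
    F(1 - x) = F(x), and S_(w,n) is k^w F(h/k) - h^w F(k/h) up to a multiple
    of h^w - k^w; the relations follow formally (Sform_mem).

    Dimension.  The antisymmetrizer maps the even antisymmetric forms onto
    the alternating forms.  If a linear functional kills the image, its value
    on the antisymmetrization of (l x + y)^w is a polynomial in l which is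
    odd, because its even coefficients are values on the image, and changes
    sign under l -> 1 - l, because that is a transposition in S3.  It is
    therefore periodic, so it vanishes (coef_functional_alternate).  Counting
    the alternating forms gives the bound d_w + 1 (dim_Uplus_le).

    Independence.  Let sum_i c_i S_(w,n_i) be a multiple of h^w - k^w and let
    F be the same combination of the polynomials above, with its constant term
    adjusted.  The hypothesis makes F palindromic, so that q(x) = F(- x) is an
    S3-invariant form, and q(x) - q(- x) = sum_i c_i (x^n_i + x^(w-n_i)).  The
    invariant forms of degree w have the basis
      (x^2 + xy + y^2)^(m-3b) (xyz)^(2b),   0 <= b <= m/3   (S3_invariant_span),
    and q has only d_w pairs of nonzero odd coefficients, which leaves m/3 + 1
    odd coefficients that vanish.  That forces q = 0 because every maximal
    minor of the matrix of odd coefficients of these basis elements is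
    positive (minor_odd_rows_gt0).

    The positivity comes from a factorization.  With t = xy, s = x^2 + y^2 and
    v = s + t a basis element is t^(2b) (v + t)^b v^(m-3b).  Expanding it in
    powers of t and v, substituting v = s + t, discarding the even powers of t
    and expanding s and t^2 in x^2 and y^2 are four operations on the rows of
    a matrix; the third selects rows, and the others are iterations of the
    step that adds to each row a nonnegative multiple of the previous one.
    That step keeps all maximal minors nonnegative (add_prev_ge0). *)

Set Implicit Arguments.
Unset Strict Implicit.
Unset Printing Implicit Defensive.

Import Order.TTheory GRing.Theory Num.Theory.
Local Open Scope ring_scope.

(** * Total positivity: adding to each row a multiple of the previous one *)

Section TotalPositivity.
Variables (R : numDomainType) (k : nat).
Implicit Types (M : nat -> 'I_k -> R) (f h : 'I_k -> nat) (lam : nat -> R).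

Definition increasing f := {homo f : i j / (i < j)%N}.

Definition minor M f : R := \det (\matrix_(i, j) M (f i) j).

Definition add_prev lam M (e : nat) (j : 'I_k) : R :=
  M e j + lam e * M e.-1 j.

(** Multilinearity of the determinant in its rows: g records the rows in
    which the previous row is chosen. *)
Lemma minor_add_prev lam M f :
  minor (add_prev lam M) f =
  \sum_(g : {ffun 'I_k -> bool})
    (\prod_i (if g i then lam (f i) else 1)) * minor M (fun i => f i - g i)%N.
Proof.
rewrite /minor /determinant.
transitivity (\sum_(s : 'S_k) \sum_(g : {ffun 'I_k -> bool}) (-1) ^+ s *
   \prod_i ((if g i then lam (f i) else 1) * M (f i - g i)%N (s i))).
  apply: eq_bigr => s _; rewrite -mulr_sumr; congr (_ * _).
  rewrite -(bigA_distr_bigA (fun i (b : bool) =>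
    (if b then lam (f i) else 1) * M (f i - b)%N (s i))).
  by apply: eq_bigr => i _; rewrite mxE big_bool /= mul1r subn0 subn1 addrC.
rewrite exchange_big; apply: eq_bigr => g _; rewrite mulr_sumr.
apply: eq_bigr => s _; rewrite big_split /= mulrCA; congr (_ * (_ * _)).
by apply: eq_bigr => i _; rewrite mxE.
Qed.

Definition minors_ge0 M := forall f, increasing f -> 0 <= minor M f.

Lemma minor_eq_rows M f h : f =1 h -> minor M f = minor M h.
Proof. by move=> fh; congr (\det _); apply/matrixP => i j; rewrite !mxE fh. Qed.

(** As f is strictly increasing, the rows f - g are weakly increasing; if two
    of them agree the minor vanishes, and otherwise it is a minor of M. *)
Lemma add_prev_term_ge0 lam M f (g : {ffun 'I_k -> bool}) :
    lam 0%N = 0 -> (forall e, 0 <= lam e) -> minors_ge0 M -> increasing f ->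
  0 <= (\prod_i (if g i then lam (f i) else 1)) *
       minor M (fun i => f i - g i)%N.
Proof.
move=> lam0 lam_ge0 Mge0 incf.
have p_ge0 : 0 <= \prod_i (if g i then lam (f i) else 1).
  by apply: prodr_ge0 => i _; case: ifP.
case: (pickP (fun i => g i && (f i == 0)%N)) => [i /andP[gi /eqP fi]|gf].
  by rewrite (bigD1 i) //= gi fi lam0 !mul0r.
apply: mulr_ge0 => //.
case: (pickP (fun p : 'I_k * 'I_k => (p.1 < p.2)%N &&
   (f p.1 - g p.1 == f p.2 - g p.2)%N)) => [[i j] /= /andP[ltij /eqP e]|ne].
  rewrite /minor (@determinant_alternate _ _ _ i j) //.
    by rewrite neq_ltn ltij.
  by move=> l; rewrite !mxE e.
apply: Mge0 => i j ltij.
have := ne (i, j); have := gf i; have := gf j; have := incf _ _ ltij => /=.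
rewrite ltij /=; case: (g i); case: (g j); rewrite /= ?subn0 ?subn1; lia.
Qed.

Lemma add_prev_ge0 lam M : lam 0%N = 0 -> (forall e, 0 <= lam e) ->
  minors_ge0 M -> minors_ge0 (add_prev lam M).
Proof.
move=> lam0 lam_ge0 Mge0 f incf; rewrite minor_add_prev.
by apply: sumr_ge0 => g _; apply: add_prev_term_ge0.
Qed.

(** The rows h select one positive term in an expansion whose terms are all
    nonnegative. *)
Lemma add_prev_gt0 lam M f h : lam 0%N = 0 -> (forall e, 0 <= lam e) ->
    minors_ge0 M -> increasing f ->
    (forall i, h i = f i \/ (h i).+1 = f i /\ 0 < lam (f i)) ->
  0 < minor M h -> 0 < minor (add_prev lam M) f.
Proof.
move=> lam0 lam_ge0 Mge0 incf hf Mh; rewrite minor_add_prev.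
pose g := [ffun i => h i != f i].
rewrite (bigD1 g) //= ltr_wpDr //.
  by apply: sumr_ge0 => g' _; apply: add_prev_term_ge0.
apply: mulr_gt0.
  apply: prodr_gt0 => i _; rewrite ffunE; case: (hf i) => [->|[e lt0]].
    by rewrite eqxx.
  by case: ifP.
rewrite (minor_eq_rows _ (h := h)) // => i; rewrite ffunE.
case: (hf i) => [->|[<- _]]; first by rewrite eqxx subn0.
by rewrite neq_ltn ltnSn subn1.
Qed.

Lemma increasing_geq f : increasing f -> forall i : 'I_k, (i <= f i)%N.
Proof.
move=> incf [n]; elim: n => // n IHn ltn.
exact: leq_ltn_trans (IHn (ltnW ltn)) (incf (Ordinal _) (Ordinal ltn) _).
Qed.

Lemma increasing_leq f n : increasing f -> (forall i, f i < k + n)%N ->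
  forall i : 'I_k, (f i <= i + n)%N.
Proof.
move=> incf bf i; have [d] := ubnP (k - i); elim: d i => // d IHd i ltd.
case: (ltnP i.+1 k) => [lti|gei].
  have := IHd (Ordinal lti); have := incf i (Ordinal lti) (ltnSn _) => /=.
  by lia.
by have := bf i; have := ltn_ord i; lia.
Qed.

End TotalPositivity.

(** * The odd coefficients of the basic S3-invariant forms *)

Section Stages.
Variables (R : numDomainType) (k : nat).

(** Column b holds the coefficients of t^(2b) (1 + t)^(b + 1 - c), and of
    t^(2b) if b < c.  Lowering c from k + 1 to 1 multiplies the columns b >= c by
    1 + t one step at a time. *)
Definition seed_coef (c e : nat) (b : 'I_k) : R :=
  if (2 * b <= e)%N then 'C(b.+1 - c, e - 2 * b)%:R else 0.

(** At stage c + 1 the columns b >= c live in rows >= 2c, and each other column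
    is concentrated in a single row below 2c, which the step leaves alone. *)
Lemma seed_coef_step c :
  (0 < c <= k)%N ->
  seed_coef c =2 add_prev (fun e => (2 * c < e)%:R) (seed_coef c.+1).
Proof.
move=> /andP[c0 ck] e b; rewrite /seed_coef /add_prev.
case: e => [|e] /=; first by rewrite mul0r addr0; case: ifP => // _; congr (_%:R);
  case: b => [[|b] ltb] //=; rewrite /= ?muln0 ?subn0 ?bin0.
case: (leqP c b) => [cb|bc].
  have -> : (b.+1 - c = (b.+1 - c.+1).+1)%N by lia.
  case: (ltngtP (2 * b) e.+1)%N => h.
  - have -> : (2 * b <= e)%N by lia.
    have -> : (2 * c < e.+1)%N by lia.
    have -> : (e.+1 - 2 * b = (e - 2 * b).+1)%N by lia.
    by rewrite binS natrD mul1r.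
  - by rewrite (_ : (2 * b <= e)%N = false) ?mulr0 ?addr0 //; lia.
  - by rewrite h subnn !bin0 (_ : (e.+1 <= e)%N = false) ?mulr0 ?addr0 //; lia.
have -> : (b.+1 - c = 0)%N by lia.
have -> : (b.+1 - c.+1 = 0)%N by lia.
rewrite [X in _ = _ + X](_ : _ = 0) ?addr0 //.
case: (ltnP (2 * c) e.+1) => h; rewrite ?mul0r // mul1r.
have -> : (2 * b <= e)%N by lia.
by rewrite bin0n (_ : (e - 2 * b == 0)%N = false) //; lia.
Qed.

Lemma minor_eq_mx (M N : nat -> 'I_k -> R) f : M =2 N -> minor M f = minor N f.
Proof. by move=> MN; congr (\det _); apply/matrixP => i j; rewrite !mxE MN. Qed.

Definition even_rows (i : 'I_k) : nat := (2 * i)%N.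

Lemma seed_coef_init c : (k <= c)%N -> forall e b, seed_coef c.+1 e b = (e == 2 * b)%N%:R.
Proof.
move=> kc e b; rewrite /seed_coef (_ : b.+1 - c.+1 = 0)%N; last by have := ltn_ord b; lia.
rewrite bin0n; case: (ltngtP (2 * b) e)%N => [h|//|->]; last by rewrite subnn.
by rewrite subn_eq0 leqNgt h.
Qed.

Lemma increasing_even_rows : increasing even_rows.
Proof. by move=> i j; rewrite /even_rows; lia. Qed.

(** Only the rows 2b are nonzero, and even_rows is the only increasing choice
    among them. *)
Lemma seed_init_minors :
  minors_ge0 (seed_coef k.+1) /\ 0 < minor (seed_coef k.+1) even_rows.
Proof.
have mev : minor (seed_coef k.+1) even_rows = 1.
  rewrite /minor -[RHS](det1 R k); congr (\det _); apply/matrixP => i j.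
  by rewrite !mxE seed_coef_init // /even_rows eqn_pmul2l.
split; last by rewrite mev ltr01.
move=> f incf.
case: (pickP (fun i : 'I_k => ~~ [exists j : 'I_k, f i == 2 * j]%N)) => [i|ex].
  rewrite negb_exists => /forallP nf; rewrite /minor (expand_det_row _ i) big1 //.
  by move=> j _; rewrite mxE seed_coef_init // (negbTE (nf j)) mul0r.
rewrite (minor_eq_rows _ (h := even_rows)) ?mev // => i.
have fE j : exists l : 'I_k, f j = (2 * l)%N.
  by have /negbFE/existsP[l /eqP] := ex j; exists l.
have inc2 : increasing (fun j => (f j)./2).
  move=> j l /incf; have [a ->] := fE j; have [b ->] := fE l; lia.
have lt2 j : ((f j)./2 < k + 0)%N.
  by have [l ->] := fE j; have := ltn_ord l; lia.
have := increasing_geq inc2 i; have := increasing_leq inc2 lt2 i.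
by rewrite /even_rows; have [l ->] := fE i; lia.
Qed.

Lemma seed_minors c : (0 < c <= k.+1)%N ->
  minors_ge0 (seed_coef c) /\ 0 < minor (seed_coef c) even_rows.
Proof.
move=> /andP[c0]; move: c0; have [d] := ubnP (k.+1 - c); elim: d c => // d IHd c ltd c0.
rewrite leq_eqVlt => /orP[/eqP->|ltc]; first exact: seed_init_minors.
have [|//|//|ge0 gt0] := IHd c.+1; first by lia.
have step := seed_coef_step (c := c); rewrite c0 /= -ltnS ltc in step.
have {}step := step isT.
split=> [f incf|]; rewrite (minor_eq_mx _ step).
  by apply: add_prev_ge0.
apply: (@add_prev_gt0 _ _ _ _ _ even_rows) => //; first exact: increasing_even_rows.
by left.
Qed.

(** The substitution v = s + t in a form of degree n: multiplication by s + t
    raises the degree by one, while row n + 1 still carries the original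
    coefficient of t^(n+1). *)
Fixpoint pascal_steps (M : nat -> 'I_k -> R) (n : nat) : nat -> 'I_k -> R :=
  if n is n'.+1 then add_prev (fun e => (0 < e <= n)%:R) (pascal_steps M n') else M.

Lemma pascal_steps_ge0 M n : minors_ge0 M -> minors_ge0 (pascal_steps M n).
Proof. by move=> M0; elim: n => //= n IHn; apply: add_prev_ge0. Qed.

(** A minor is positive as soon as its rows can be lowered to even_rows by
    the available steps; row e is first affected by step e. *)
Lemma pascal_steps_gt0 M n f : minors_ge0 M -> 0 < minor M even_rows -> increasing f ->
  (forall i, (even_rows i <= f i)%N && ((f i <= n)%N || (f i == even_rows i))) ->
  0 < minor (pascal_steps M n) f.
Proof.
move=> M0 Mev; elim: n f => [|n IHn] f incf fb /=.
  by rewrite (minor_eq_rows _ (h := even_rows)) // => i; have := fb i; lia.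
(* Lower by one every row that has not reached its target. *)
pose h i := if (f i == even_rows i)%N then f i else (f i).-1.
have hb i : (even_rows i <= h i)%N && ((h i <= n)%N || (h i == even_rows i)).
  by have := fb i; rewrite /h; case: eqP; lia.
apply: (@add_prev_gt0 _ _ _ _ _ h) => //.
- exact: pascal_steps_ge0.
- move=> i; rewrite /h; case: eqP => [|/eqP ne]; first by left.
  have /andP[le1 le2] := fb i; right; split; first by lia.
  by rewrite (_ : (0 < f i <= n.+1)%N) ?ltr01 //; lia.
apply: IHn => // i j ltij; have := incf _ _ ltij; have := increasing_even_rows ltij.
by have := fb i; have := fb j; rewrite /h; case: eqP; case: eqP; lia.
Qed.

Lemma pascal_steps_above M n e b : (n < e)%N -> pascal_steps M n e b = M e b.
Proof.
elim: n e => //= n IHn e lt; rewrite /add_prev IHn; last exact: ltnW.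
by rewrite (_ : (0 < e <= n.+1)%N = false) ?mul0r ?addr0 //; lia.
Qed.

Lemma pascal_steps_form (A : comPzRingType) (rho : {rmorphism R -> A}) M n b (s t : A) :
  \sum_(e < n.+1) rho (pascal_steps M n e b) * (s ^+ (n - e) * t ^+ e) =
  \sum_(e < n.+1) rho (M e b) * ((s + t) ^+ (n - e) * t ^+ e).
Proof.
elim: n => [|n IHn]; first by rewrite !big_ord1.
rewrite [RHS]big_ord_recr /= subnn expr0 mul1r.
have -> : \sum_(i < n.+1) rho (M i b) * ((s + t) ^+ (n.+1 - i) * t ^+ i) =
   (s + t) * \sum_(e < n.+1) rho (M e b) * ((s + t) ^+ (n - e) * t ^+ e).
  rewrite mulr_sumr; apply: eq_bigr => i _.
  by rewrite subSn -1?ltnS // exprS; ring.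
rewrite -IHn /add_prev.
transitivity (\sum_(e < n.+2) rho (pascal_steps M n e b) * (s ^+ (n.+1 - e) * t ^+ e) +
  \sum_(e < n.+2) rho ((0 < e <= n.+1)%:R * pascal_steps M n e.-1 b) *
    (s ^+ (n.+1 - e) * t ^+ e)).
  by rewrite -big_split; apply: eq_bigr => i _; rewrite rmorphD mulrDl.
rewrite big_ord_recr /= subnn expr0 mul1r (pascal_steps_above _ _ (ltnSn n)).
rewrite [X in _ + X]big_ord_recl /= mul0r rmorph0 mul0r add0r.
set U := \sum_(i < n.+1) _; set V := \sum_(i < n.+1) _; set W := rho _ * _.
have -> : U = s * \sum_(e < n.+1) rho (pascal_steps M n e b) * (s ^+ (n - e) * t ^+ e).
  rewrite mulr_sumr; apply: eq_bigr => i _.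
  by rewrite subSn -1?ltnS // exprS; ring.
have -> : V = t * \sum_(e < n.+1) rho (pascal_steps M n e b) * (s ^+ (n - e) * t ^+ e).
  rewrite mulr_sumr; apply: eq_bigr => i _.
  rewrite /= /bump /= add1n ltn_ord mul1r subSS exprS add0n.
  by ring.
by rewrite mulrDl addrAC.
Qed.

(** For 2j <= n, row j is the coefficient of X^j in
    sum_l M_l X^l (1 + X)^(n - 2l), a palindromic polynomial determined by these
    rows; the rows beyond the middle wait to be used at a higher degree. *)
Definition central_fold (M : nat -> 'I_k -> R) (n j : nat) (b : 'I_k) : R :=
  if (2 * j <= n)%N then \sum_(l < j.+1) M l b * 'C(n - 2 * l, j - l)%:R
  else M j b.

(** Multiplication by 1 + X adds adjacent coefficients.  When n + 1 = 2j is even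
    the two neighbours of the new middle coefficient are equal by symmetry, hence
    the factor 2. *)
Lemma central_fold_step M n : central_fold M n.+1 =2
  add_prev (fun j => if (0 < j)%N then
     if (2 * j < n.+1)%N then 1 else if (2 * j == n.+1)%N then 2%:R else 0 else 0)
     (central_fold M n).
Proof.
move=> j b; rewrite /add_prev; case: j => [|j].
  by rewrite mul0r addr0 /central_fold !muln0 !leq0n !big_ord1 /= !bin0.
rewrite ltn0Sn; case: ltngtP => h.
- rewrite /central_fold [RHS]addrC.
  have -> : (2 * j.+1 <= n.+1)%N by lia.
  have -> : (2 * j.+1 <= n)%N by lia.
  have -> : (2 * j.+1.-1 <= n)%N by lia.
  rewrite [LHS]big_ord_recr [X in _ = _ + X]big_ord_recr /= !subnn !bin0 mul1r addrA.
  congr (_ + _); rewrite -big_split; apply: eq_bigr => i _ /=.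
  have := ltn_ord i => lti.
  have -> : (n.+1 - 2 * i = (n - 2 * i).+1)%N by lia.
  have -> : (j.+1 - i = (j - i).+1)%N by lia.
  by rewrite binS natrD mulrDr addrC.
- rewrite mul0r addr0 /central_fold (_ : (2 * j.+1 <= n.+1)%N = false); last by lia.
  by rewrite (_ : (2 * j.+1 <= n)%N = false) //; lia.
- rewrite /central_fold h leqnn.
  have -> : (n.+1 <= n)%N = false by lia.
  have -> : (2 * j.+1.-1 <= n)%N by lia.
  rewrite [LHS]big_ord_recr /= subnn bin0 mulr1 addrC; congr (_ + _).
  rewrite mulr_sumr; apply: eq_bigr => i _.
  have := ltn_ord i => lti.
  have -> : (n.+1 - 2 * i = (j - i).*2.+2)%N by lia.
  have -> : (n - 2 * i = (j - i).*2.+1)%N by lia.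
  have -> : (j.+1 - i = (j - i).+1)%N by lia.
  rewrite mulrCA; congr (_ * _).
  rewrite -natrM mul2n -[X in _ = X%:R]addnn binS -[X in (X + _)%N]bin_sub; last by lia.
  by congr (('C(_, _) + _)%N)%:R; lia.
Qed.

Lemma central_fold_minors M n : minors_ge0 M ->
  minors_ge0 (central_fold M n) /\
  forall f, increasing f -> 0 < minor M f -> 0 < minor (central_fold M n) f.
Proof.
move=> M0; elim: n => [|n [IH0 IH1]].
  suff e : central_fold M 0 =2 M by split=> f incf; rewrite (minor_eq_mx _ e) //; apply: M0.
  by move=> [|j] b; rewrite /central_fold //= big_ord1 bin0 mulr1.
have step := @central_fold_step M n.
split=> f incf; rewrite (minor_eq_mx _ step).
  apply: add_prev_ge0 => // j; do 3?case: ifP => //.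
move=> Mf; apply: (@add_prev_gt0 _ _ _ _ _ f) => //; last exact: IH1.
  by move=> j; do 3?case: ifP.
by left.
Qed.

End Stages.

Section OddCoefficients.
Variable R : numFieldType.

(** (x^2 + xy + y^2)^(m-3b) (xyz)^(2b) at y = 1, where z = - x - y. *)
Definition S3_form (m b : nat) : {poly R} :=
  (1 + 'X + 'X ^+ 2) ^+ (m - 3 * b) * ('X * (1 + 'X)) ^+ (2 * b).

(** The dimension of the space of S3-invariant forms of degree 2m. *)
Definition S3_dim (m : nat) : nat := (m %/ 3).+1.

(** At y = 1 the variables t = xy and v become x and 1 + x + x^2, and
    (xyz)^2 = t^2 (v + t) because v + t = (x + y)^2. *)
Lemma S3_form_expand m (b : nat) : (3 * b <= m)%N ->
  S3_form m b = \sum_(e < m.+1) (if (2 * b <= e)%N then 'C(b, e - 2 * b)%:R else 0)%:P *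
     ((1 + 'X^2 + 'X) ^+ (m - e) * 'X ^+ e).
Proof.
move=> le3.
pose v : {poly R} := 1 + 'X^2 + 'X.
pose L i := v ^+ (m - 3 * b) * 'X^(2 * b) * ((v ^+ (b - i) * 'X ^+ i) *+ 'C(b, i)).
pose Q e := (if (2 * b <= e)%N then 'C(b, e - 2 * b)%:R else 0)%:P *
  (v ^+ (m - e) * 'X ^+ e).
transitivity (\sum_(i < b.+1) L i).
  rewrite -mulr_sumr -exprDn /S3_form -mulrA; congr (_ ^+ _ * _); first by rewrite /v; ring.
  rewrite exprMn; congr (_ * _).
  by rewrite exprM; congr (_ ^+ _); rewrite /v; ring.
rewrite -(big_mkord xpredT L) -(big_mkord xpredT Q) /L /Q.
rewrite [RHS](@big_cat_nat _ _ _ (2 * b)) //=; last by lia.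
rewrite [X in _ = X + _]big_nat [X in _ = X + _]big1 ?add0r; last first.
  by move=> i /= lti; rewrite leqNgt lti mul0r.
rewrite -{2}[(2 * b)%N]add0n big_addn.
rewrite [RHS](@big_cat_nat _ _ _ b.+1) //=; last by lia.
rewrite [X in _ = _ + X]big_nat [X in _ = _ + X]big1 ?addr0; last first.
  by move=> i /andP[lti _]; rewrite leq_addl addnK bin_small // mul0r.
apply: eq_big_nat => i /= lti.
rewrite leq_addl addnK polyC_natr exprD.
have -> : (m - (i + 2 * b) = (m - 3 * b) + (b - i))%N by lia.
by rewrite exprD -mulr_natl; ring.
Qed.

Lemma big_even_odd (G : nat -> R) n :
  \sum_(e < 2 * n) G e = \sum_(l < n) (G (2 * l)%N + G (2 * l).+1).
Proof.
elim: n => [|n IHn]; first by rewrite !big_ord0.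
by rewrite mulnS !addSn add0n !big_ord_recr /= IHn addrA.
Qed.

Lemma coef_1DX2_exp n i : ((1 + 'X^2) ^+ n : {poly R})`_i =
  if odd i then 0 else 'C(n, i./2)%:R.
Proof.
rewrite exprDn coef_sum.
transitivity (\sum_(l < n.+1) (i == 2 * l)%N%:R * 'C(n, l)%:R : R).
  apply: eq_bigr => l _; rewrite expr1n mul1r coefMn -exprM coefXn.
  by rewrite mulr_natr.
case: ifP => oi.
  by rewrite big1 // => l _; case: eqP => [e|]; [move: oi;
    rewrite e mul2n odd_double | rewrite mul0r].
case: (ltnP (i./2) n.+1) => h.
  rewrite (bigD1 (Ordinal h)) //= big1 ?addr0.
    by rewrite (_ : (i == 2 * i./2)%N) ?mul1r //; lia.
  by move=> l /eqP ne; case: eqP => [e|]; rewrite ?mul0r //; case: ne;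
    apply: val_inj => /=; lia.
rewrite bin_small // big1 // => l _; case: eqP => [e|]; rewrite ?mul0r //.
by have := ltn_ord l; lia.
Qed.

(** The odd powers of t = xy in S3_form, expanded in x^2; row j stands for
    the coefficient of x^(2j+1). *)
Definition odd_rows m : nat -> 'I_(S3_dim m) -> R :=
  central_fold (fun l => pascal_steps (@seed_coef R (S3_dim m) 1) m (2 * l).+1) m.-1.

Lemma S3_dim_le m (b : 'I_(S3_dim m)) : (3 * b <= m)%N.
Proof. by have := ltn_ord b; rewrite /S3_dim; lia. Qed.

Lemma coef_S3_form_odd m (b : 'I_(S3_dim m)) j : (2 * j < m)%N ->
  (S3_form m b)`_(2 * j).+1 = @odd_rows m j b.
Proof.
move=> ltj; rewrite S3_form_expand ?S3_dim_le //.
transitivity ((\sum_(e < m.+1) (pascal_steps (@seed_coef R (S3_dim m) 1) m e b)%:P *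
     ((1 + 'X^2) ^+ (m - e) * 'X ^+ e))`_(2 * j).+1).
  rewrite (pascal_steps_form (@polyC R)); congr (polyseq _)`__; apply: eq_bigr => e _.
  by rewrite /seed_coef subn1.
rewrite coef_sum /odd_rows /central_fold (_ : (2 * j <= m.-1)%N); last by lia.
pose G e : R := pascal_steps (@seed_coef R (S3_dim m) 1) m e b *
  ((1 + 'X^2) ^+ (m - e) * 'X ^+ e : {poly R})`_(2 * j).+1.
transitivity (\sum_(e < 2 * j.+1) G e).
  rewrite [RHS](big_ord_widen m.+1 G); last by lia.
  rewrite [RHS]big_mkcond; apply: eq_bigr => i _; rewrite coefCM.
  case: ifP => // /negbT; rewrite -leqNgt => lei.
  by rewrite coefMXn (_ : ((2 * j).+1 < i)%N) ?mulr0 //; lia.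
rewrite big_even_odd; apply: eq_bigr => l _; have := ltn_ord l => ltl.
rewrite /G !coefMXn !coef_1DX2_exp.
have -> : ((2 * j).+1 < 2 * l)%N = false by lia.
have -> : ((2 * j).+1 < (2 * l).+1)%N = false by lia.
have -> : odd ((2 * j).+1 - 2 * l) by lia.
have -> : odd ((2 * j).+1 - (2 * l).+1) = false by lia.
by rewrite mulr0 add0r; congr (_ * 'C(_, _)%:R); lia.
Qed.

(** Row j of the matrix comes from t^(2j+1), and an increasing f satisfies
    2i <= 2 f(i) + 1 <= m, which is the range where the Pascal steps reach
    positivity. *)
Lemma minor_odd_rows_gt0 m (f : 'I_(S3_dim m) -> nat) : increasing f ->
  (forall i, (2 * f i < m)%N) -> 0 < minor (@odd_rows m) f.
Proof.
move=> incf fm; have [A0 A1] := @seed_minors R (S3_dim m) 1 isT.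
have inc2 g : increasing g -> increasing (fun i : 'I_(S3_dim m) => (2 * g i).+1).
  by move=> incg i j /incg; lia.
have mE (M : nat -> 'I_(S3_dim m) -> R) g :
  minor (fun l => M (2 * l).+1) g = minor M (fun i => (2 * g i).+1).
  by congr (\det _); apply/matrixP => i j; rewrite !mxE.
apply: (proj2 (central_fold_minors _ _)) => //.
  by move=> g incg; rewrite mE; apply: pascal_steps_ge0 => //; apply: inc2.
rewrite mE; apply: pascal_steps_gt0 => //; first exact: inc2.
by move=> i; have := increasing_geq incf i; have := fm i; rewrite /even_rows; lia.
Qed.

(** An S3-invariant form is determined by any S3_dim m of its odd coefficients
    up to degree m. *)
Lemma S3_form_odd_coefs_eq0 m (al : 'I_(S3_dim m) -> R) (f : 'I_(S3_dim m) -> nat) :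
    increasing f -> (forall i, (2 * f i < m)%N) ->
    (forall i, (\sum_b al b *: S3_form m b)`_(2 * f i).+1 = 0) ->
  forall b, al b = 0.
Proof.
move=> incf fm al0 b.
pose A := \matrix_(i, j) @odd_rows m (f i) j.
have detA : \det A != 0 by apply: lt0r_neq0; apply: minor_odd_rows_gt0.
pose v := \col_j al j.
have Av : A *m v = 0.
  apply/matrixP => i j; rewrite !mxE -[RHS](al0 i) coef_sum.
  by apply: eq_bigr => l _; rewrite !mxE coefZ coef_S3_form_odd // mulrC.
have : v = 0.
  by rewrite -(@mulKmx _ _ _ A _ v) ?Av ?mulmx0 // unitmxE unitfE.
by move/matrixP/(_ b 0); rewrite !mxE.
Qed.

End OddCoefficients.

(** * Forms invariant under S3 *)

Section Invariants.
Variable K : numFieldType.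
Implicit Types (p q : {poly K}).

Lemma poly_eq0_nat p : (forall n : nat, p.[n.+1%:R] = 0) -> p = 0.
Proof.
move=> p0; pose rs := [seq i.+1%:R : K | i <- iota 0 (size p)].
apply: (@roots_geq_poly_eq0 _ p rs); last by rewrite size_map size_iota.
  by apply/allP => _ /mapP[i _ ->]; rewrite rootE p0.
by rewrite map_inj_uniq ?iota_uniq // => i j /eqP; rewrite eqr_nat => /eqP[].
Qed.

Lemma poly_eq_nat p q : (forall n : nat, p.[n.+1%:R] = q.[n.+1%:R]) -> p = q.
Proof.
move=> pq; apply/eqP; rewrite -subr_eq0; apply/eqP/poly_eq0_nat => n.
by rewrite hornerD hornerN pq subrr.
Qed.

Lemma horner_one (x : K) : (1 : {poly K}).[x] = 1.
Proof. exact: hornerC. Qed.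

Definition horner_ops :=
  (hornerD, hornerN, hornerM, hornerZ, horner_exp, hornerX, hornerC, horner_one).

(** Invariance of y^w q(x/y) for w even, tested on the transpositions that
    exchange x with z = - x - y and x with y. *)
Definition S3_invariant (w : nat) q : Prop :=
  [/\ (size q <= w.+1)%N, forall x, q.[- 1 - x] = q.[x]
    & forall x, x != 0 -> x ^+ w * q.[x^-1] = q.[x]].

Lemma natS_neq0 n : n.+1%:R != 0 :> K.
Proof. by rewrite pnatr_eq0. Qed.

Lemma S3_invariant_rev w q i : S3_invariant w q -> (i <= w)%N -> q`_i = q`_(w - i).
Proof.
case=> sq _ rev lei.
suff e : q = \poly_(j < w.+1) q`_(w - j) by rewrite [in LHS]e coef_poly ltnS lei.
apply: poly_eq_nat => n; rewrite -rev ?natS_neq0 //.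
rewrite horner_poly (horner_coef_wide _ sq) mulr_sumr (reindex_inj rev_ord_inj) /=.
apply: eq_bigr => j _; have := ltn_ord j; rewrite ltnS subSS => lej.
rewrite mulrCA; congr (_ * _).
have -> : n.+1%:R ^+ w = n.+1%:R ^+ (w - j) * n.+1%:R ^+ j :> K by rewrite -exprD subnK.
by rewrite exprVn mulrAC divff ?mul1r // expf_neq0 ?natS_neq0.
Qed.

(** The transposition of y and z fixes x and multiplies a lowest term in x^k by
    (-1)^k, so the order of vanishing at x = 0 is even. *)
Lemma S3_invariant_odd w q k : S3_invariant w q -> ~~ odd w -> odd k ->
  (forall i, (i < k)%N -> q`_i = 0) -> q`_k = 0.
Proof.
case=> sq trans rev ew ok q0.
case: (ltnP w k) => [ltk|lek]; first by rewrite nth_default // (leq_trans sq).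
have e : q = \sum_(i < w.+1) q`_i *: ((- 'X) ^+ i * (1 + 'X) ^+ (w - i)).
  apply: poly_eq_nat => n; rewrite horner_sum; set x : K := n.+1%:R.
  have x0 : x != 0 by exact: natS_neq0.
  have y0 : 1 + x != 0 by rewrite /x -[1]/(1%:R) -natrD natS_neq0.
  (* The transposition of y and z, composed from the two given ones. *)
  have -> : q.[x] = (1 + x) ^+ w * q.[- x / (1 + x)].
    rewrite -trans -rev; last by rewrite -opprD oppr_eq0.
    rewrite -opprD exprNn -signr_odd (negbTE ew) expr0 mul1r; congr (_ * _).
    rewrite -trans invrN opprK; congr (q.[_]).
    clearbody x; field; exact: y0.
  rewrite (horner_coef_wide _ sq) mulr_sumr; apply: eq_bigr => i _.
  have lei : (i <= w)%N by rewrite -ltnS.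
  rewrite !horner_ops mulrCA.
  congr (_ * _).
  have -> : (1 + x) ^+ w = (1 + x) ^+ (w - i) * (1 + x) ^+ i by rewrite -exprD subnK.
  rewrite exprMn exprVn mulrCA; congr (_ * _).
  by rewrite mulfK // expf_neq0.
have : q`_k = - q`_k.
  rewrite {1}e coef_sum (bigD1 (Ordinal (lek : (k < w.+1)%N))) //= big1 ?addr0.
    rewrite coefZ exprNn -signr_odd ok expr1 mulN1r mulNr coefN coefXnM.
    by rewrite ltnn subnn -horner_coef0 !horner_ops addr0 expr1n mulrN1.
  move=> i /eqP ne; case: (ltngtP i k) => h.
  - by rewrite q0 // scale0r coef0.
  - by rewrite coefZ exprNn -mulrA -signr_odd mulr_sign; case: odd;
    rewrite ?coefN coefXnM h ?oppr0 mulr0.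
  - by case: ne; apply: val_inj.
by move/eqP; rewrite -addr_eq0 -mulr2n mulrn_eq0 => /eqP.
Qed.

(** Vanishing to order k along x = 0 implies the same along y = 0 and z = 0,
    which takes up 3k of the w zeros. *)
Lemma S3_invariant_order w q k : S3_invariant w q -> (w < 3 * k)%N ->
  (forall i, (i < k)%N -> q`_i = 0) -> q = 0.
Proof.
move=> inv ltw q0; have [sq trans rev] := inv; apply/eqP; apply/negPn/negP => qn0.
have dvdX : 'X^k %| q.
  rewrite -(poly_take_drop k q) (_ : take_poly k q = 0) ?add0r ?dvdp_mull //.
  by apply/polyP => i; rewrite coef_take_poly coef0; case: ifP => // /q0.
have dvdX1 : (- 1 - 'X) ^+ k %| q.
  have e : q = q \Po (- 1 - 'X).
    by apply: poly_eq_nat => n; rewrite horner_comp !horner_ops trans.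
  case/dvdpP: dvdX => r qr; rewrite e {1}qr rmorphM /= rmorphXn /= comp_polyX.
  exact: dvdp_mull.
have eX1 : (- 1 - 'X : {poly K}) = - ('X - (- 1)%:P) by rewrite polyCN; ring.
have : ('X^k * (- 1 - 'X) ^+ k) %| q.
  rewrite Gauss_dvdp ?dvdX ?dvdX1 // coprimep_expl ?coprimep_expr //.
  rewrite eX1 -scaleN1r coprimepZr ?oppr_eq0 ?oner_eq0 // -[X in coprimep X]subr0.
  by rewrite -[0]/(0%:P) coprimep_XsubC2 // subr0 oppr_eq0 oner_eq0.
move/dvdp_leq => /(_ qn0).
have -> : size ('X^k * (- 1 - 'X) ^+ k : {poly K}) = (k + k).+1.
  rewrite size_monicM ?monicXn //; last first.
    by rewrite expf_neq0 // eX1 oppr_eq0 polyXsubC_eq0.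
  rewrite size_polyXn eX1 exprNn -signr_odd mulr_sign.
  by case: odd; rewrite ?size_polyN size_exp_XsubC addSn /= addnS.
have : (size q <= w.+1 - k)%N.
  apply/leq_sizeP => i lei; case: (leqP i w) => [leiw|ltwi].
    by rewrite (S3_invariant_rev inv) // q0 //; lia.
  by rewrite nth_default // (leq_trans sq).
by move=> h1 h2; have := leq_trans h2 h1; move: ltw; clear; lia.
Qed.

Lemma S3_invariant_subZ w p q c :
  S3_invariant w p -> S3_invariant w q -> S3_invariant w (p - c *: q).
Proof.
case=> sp tp rp [sq tq rq]; split.
- rewrite (leq_trans (size_polyD _ _)) // geq_max sp size_polyN.
  by rewrite (leq_trans (size_scale_leq _ _)).
- by move=> x; rewrite !horner_ops tp tq.
- by move=> x x0; rewrite !horner_ops mulrBr rp // mulrCA rq.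
Qed.

Lemma S3_form_invariant m b : (3 * b <= m)%N -> S3_invariant (2 * m) (S3_form K m b).
Proof.
move=> le3; split.
- rewrite /S3_form; set A : {poly K} := 1 + _ + _; set B : {poly K} := 'X * _.
  rewrite (leq_trans (size_polyMleq _ _)) //.
  have sA : (size A <= 3)%N.
    rewrite (leq_trans (size_polyD _ _)) // geq_max size_polyXn leqnn andbT.
    by rewrite -[1]/(1%:P) addrC size_XaddC.
  have sB : (size B <= 3)%N.
    rewrite /B -[1]/(1%:P) addrC mulrC size_mulX ?size_XaddC //.
    by rewrite -size_poly_eq0 size_XaddC.
  have := size_poly_exp_leq A (m - 3 * b); have := size_poly_exp_leq B (2 * b).
  move: sA sB; clearbody A B; move: (size A) (size B) => a c.
  move: (size (A ^+ _)) (size (B ^+ _)) => u v.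
  by clear -le3; nia.
- move=> x; rewrite /S3_form !horner_ops.
  by congr (_ ^+ _ * _ ^+ _); ring.
- move=> x x0; rewrite /S3_form !horner_ops.
  have -> : x ^+ (2 * m) = (x ^+ 2) ^+ (m - 3 * b) * (x ^+ 3) ^+ (2 * b).
    by rewrite -!exprM -exprD; congr (_ ^+ _); lia.
  by rewrite mulrACA -!exprMn; congr (_ ^+ _ * _ ^+ _); field.
Qed.

Lemma coef_S3_form_lt m b i : (i < 2 * b)%N -> (S3_form K m b)`_i = 0.
Proof. by move=> lti; rewrite /S3_form exprMn mulrCA coefXnM lti. Qed.

Lemma coef_S3_form_eq m b : (S3_form K m b)`_(2 * b) = 1.
Proof.
rewrite /S3_form exprMn mulrCA coefXnM ltnn subnn -horner_coef0 !horner_ops.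
by rewrite mul0r !addr0 !expr1n mulr1.
Qed.

(** Since S3_form m b vanishes to the exact order 2b at x = 0 and only even
    orders up to 2m/3 occur, the coefficients are found one after another. *)
Lemma S3_invariant_span m q : S3_invariant (2 * m) q ->
  exists al : 'I_(S3_dim m) -> K, q = \sum_b al b *: S3_form K m b.
Proof.
move=> invq.
suff H d : (d <= S3_dim m)%N -> forall q, S3_invariant (2 * m) q ->
    (forall i, (i < 2 * (S3_dim m - d))%N -> q`_i = 0) ->
    exists al : 'I_(S3_dim m) -> K, q = \sum_b al b *: S3_form K m b.
  by apply: (H (S3_dim m)) => // i; rewrite subnn.
elim: d => [|d IHd] led {}q {}invq q0.
  exists (fun => 0); rewrite (S3_invariant_order invq _ q0).
    by rewrite big1 // => b _; rewrite scale0r.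
  by rewrite /S3_dim; lia.
have ltb : (S3_dim m - d.+1 < S3_dim m)%N by lia.
set b := (S3_dim m - d.+1)%N in ltb q0.
pose bo := Ordinal ltb.
have le3 : (3 * b <= m)%N by apply: (S3_dim_le bo).
have inv' := S3_invariant_subZ q`_(2 * b) invq (S3_form_invariant le3).
set q' := q - _ in inv'.
have q'0 i : (i < (2 * b).+1)%N -> q'`_i = 0.
  rewrite ltnS leq_eqVlt /q' coefB coefZ => /orP[/eqP->|lti].
    by rewrite coef_S3_form_eq mulr1 subrr.
  by rewrite (coef_S3_form_lt _ lti) (q0 _ lti) mulr0 subrr.
have [||al qal] := IHd _ q' inv'; first exact: ltnW.
  have -> : (2 * (S3_dim m - d) = (2 * b).+2)%N by rewrite /b; lia.
  move=> i; rewrite ltnS leq_eqVlt => /orP[/eqP->|]; last exact: q'0.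
  by apply: (S3_invariant_odd inv') => //; rewrite ?mul2n /= ?odd_double.
exists (fun i => al i + (i == bo)%:R * q`_(2 * b)).
rewrite -[LHS](subrK (q`_(2 * b) *: S3_form K m b)) -/q' qal.
under [RHS]eq_bigr do rewrite scalerDl.
rewrite big_split /=; congr (_ + _).
rewrite (bigD1 bo) //= eqxx mul1r big1 ?addr0 // => i /negbTE->.
by rewrite mul0r scale0r.
Qed.

End Invariants.

(** * Difference equations with few odd monomials *)

Section Independence.
Variable K : numFieldType.

Lemma avoiding_rows (k N d : nat) (J : 'I_d -> nat) : (d + k <= N)%N ->
  exists f : 'I_k -> nat, [/\ increasing f, forall i, (f i < N)%N &
    forall i j, f i <> J j].
Proof.
move=> led; pose s := [seq x <- iota 0 N | x \notin codom J].
have ss : (k <= size s)%N.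
  have : (size [seq x <- iota 0 N | x \in codom J] <= d)%N.
    rewrite -[X in (_ <= X)%N](card_ord d) -(size_codom J).
    apply: uniq_leq_size; first by rewrite filter_uniq ?iota_uniq.
    by move=> x; rewrite mem_filter => /andP[].
  rewrite /s !size_filter => led'.
  have e : (count (fun x => x \in codom J) (iota 0 N) +
            count (fun x => x \notin codom J) (iota 0 N) = N)%N.
    by rewrite -[RHS](size_iota 0) -(count_predC (fun x => x \in codom J)).
  by move: led' e led; move: (count _ _) (count _ _) => a b; lia.
have nthP (i : 'I_k) : nth 0%N s i \in s.
  by rewrite mem_nth // (leq_trans (ltn_ord i)).
exists (fun i => nth 0%N s i); split.
- move=> i j ltij; apply: (sorted_ltn_nth ltn_trans) => //.
  + by apply: sorted_filter; [exact: ltn_trans | exact: iota_ltn_sorted].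
  + by rewrite inE (leq_trans (ltn_ord i)).
  + by rewrite inE (leq_trans (ltn_ord j)).
- by move=> i; have := nthP i; rewrite mem_filter mem_iota => /and3P[].
- move=> i j e; have := nthP i; rewrite mem_filter e => /andP[/negP []].
  by rewrite codom_f.
Qed.

Definition palindrome (w n : nat) : {poly K} := 'X^n + 'X^(w - n).

(** The core of the linear independence: q(x) = F(- x) is S3-invariant with odd
    part half of the right-hand side, so too many of its odd coefficients
    vanish. *)
Lemma difference_independent m d (J : 'I_d -> nat) (c : 'I_d -> K) (F : {poly K}) :
    injective J -> (forall i, (2 * J i < m.-1)%N) -> (d + S3_dim m <= m.+1./2)%N ->
    (size F <= (2 * m).+1)%N ->
    (forall x, F.[x + 1] - F.[x] =
               (\sum_i c i *: palindrome (2 * m) (2 * J i).+1).[x]) ->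
    (forall x, F.[1 - x] = F.[x]) ->
    (forall x, x != 0 -> x ^+ (2 * m) * F.[x^-1] = F.[x]) ->
  forall i, c i = 0.
Proof.
move=> injJ ltJ led sF dF reflF revF.
set p := \sum_i _ in dF.
have compN (r : {poly K}) x : (r \Po - 'X).[x] = r.[- x] by rewrite horner_comp !horner_ops.
have [q qdef] : {q | q = F \Po - 'X} by exists (F \Po - 'X).
have qE x : q.[x] = F.[- x] by rewrite qdef compN.
have invq : S3_invariant (2 * m) q.
  split.
  - by rewrite qdef (leq_trans (size_comp_poly_leq _ _)) //
       size_polyN size_polyX muln1; lia.
  - by move=> x; rewrite !qE -[RHS]reflF; congr (F.[_]); ring.
  - move=> x x0; rewrite !qE -[RHS]revF ?oppr_eq0 // invrN.
    by rewrite mul2n -addnn exprNn -signr_odd oddD addbb expr0 mul1r.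
have pq : p = q - (q \Po - 'X).
  apply: poly_eq_nat => n; rewrite -dF hornerD hornerN compN !qE opprK.
  by congr (_ - _); rewrite -reflF; congr (F.[_]); ring.
have coefNX (r : {poly K}) e : (r \Po - 'X)`_e = (-1) ^+ e * r`_e.
  rewrite comp_polyE coef_sum.
  transitivity (\sum_(i < size r) (i == e :> nat)%:R * ((-1) ^+ e * r`_e)).
    apply: eq_bigr => i _; rewrite coefZ.
    have -> : ((- 'X) ^+ i : {poly K})`_e = (-1) ^+ i * (i == e :> nat)%:R.
      by rewrite -scaleN1r exprZn coefZ coefXn eq_sym.
    by case: (i =P e :> nat) => [->|]; rewrite ?mulr0 ?mul0r // mulr1 mul1r mulrC.
  case: (ltnP e (size r)) => h; last first.
    by rewrite [r`_e]nth_default // big1 ?mulr0 // => i _; rewrite !mulr0.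
  rewrite (bigD1 (Ordinal h)) //= eqxx mul1r big1 ?addr0 // => i /eqP ne.
  by case: eqP => [e'|]; rewrite ?mul0r //; case: ne; apply: val_inj.
have coefp e : odd e -> p`_e = q`_e *+ 2.
  by move=> oe; rewrite pq coefB coefNX -signr_odd oe mulN1r opprK mulr2n.
have palC e : p`_e =
    \sum_i c i * ((e == (2 * J i).+1)%:R + (e == 2 * m - (2 * J i).+1)%N%:R).
  by rewrite coef_sum; apply: eq_bigr => i _; rewrite coefZ coefD !coefXn.
have [al qal] := S3_invariant_span invq.
have [f [incf fN fJ]] := avoiding_rows J led.
have al0 : forall b, al b = 0.
  apply: (S3_form_odd_coefs_eq0 (f := f)) => // [i|i]; first by have := fN i; lia.
  rewrite -qal; apply/eqP; suff : q`_(2 * f i).+1 *+ 2 == 0 by rewrite mulrn_eq0.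
  rewrite -coefp; last by rewrite /= mul2n odd_double.
  rewrite palC big1 // => j _; have := fJ i j; have := ltJ j; have := fN i => h1 h2 h3.
  have -> : ((2 * f i).+1 == (2 * J j).+1) = false by lia.
  have -> : ((2 * f i).+1 == 2 * m - (2 * J j).+1)%N = false by lia.
  by rewrite addr0 mulr0.
have q0 : q = 0 by rewrite qal big1 // => b _; rewrite al0 scale0r.
have p0 : p = 0 by rewrite pq q0 comp_poly0 subr0.
move=> i; have := palC (2 * J i).+1; rewrite p0 coef0 (bigD1 i) //= big1.
  rewrite eqxx (_ : ((2 * J i).+1 == 2 * m - (2 * J i).+1)%N = false);
    last by have := ltJ i; lia.
  by rewrite !addr0 mulr1.
move=> j ne; have := ltJ i; have := ltJ j => h1 h2.
have -> : ((2 * J i).+1 == (2 * J j).+1) = false.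
  by apply/eqP => -[] e; case/eqP: ne; apply: injJ; lia.
have -> : ((2 * J i).+1 == 2 * m - (2 * J j).+1)%N = false by lia.
by rewrite addr0 mulr0.
Qed.

End Independence.

(** * Bernoulli polynomials and membership of the forms S *)

Section BernoulliDifference.
Variable K : numFieldType.

(** B_n(x + 1) is the convolution of B(x) with e^t, and the terms other than
    B_n(x) are those of the generating identity (e^t - 1) B(x) = t e^(xt). *)
Lemma bernoulli_poly_difference n x :
  (bernoulli_poly K n.+1).[x + 1] - (bernoulli_poly K n.+1).[x] = n.+1%:R * x ^+ n.
Proof.
pose inv i : K := fps_inv (fun j => (j.+1)`!%:R^-1) i.
pose E y i : K := y ^+ i / i`!%:R.
pose b y i : K := i`!%:R^-1 * (bernoulli_poly K i).[y].
have bE y i : b y i = fps_mul inv (E y) i.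
  rewrite /b /bernoulli_poly hornerZ mulKf ?natf_fact_neq0 // /fps_mul horner_sum.
  by apply: eq_bigr => k _; rewrite hornerM hornerC hornerZ hornerXn [_^-1 * _]mulrC.
(* e^((y+1)t) = e^(yt) e^t. *)
have ED y i : E (y + 1) i = fps_mul (E y) (E 1) i.
  rewrite /E /fps_mul exprDn mulr_suml; rewrite (reindex_inj rev_ord_inj) /=.
  apply: eq_bigr => k _; have := ltn_ord k; rewrite ltnS subSS => lek.
  rewrite subKn // !expr1n mulr1 mul1r bin_sub // -[_ *+ _]mulr_natr.
  have -> : 'C(i, k)%:R = i`!%:R / (k`!%:R * (i - k)`!%:R) :> K.
    by rewrite -(bin_fact lek) !natrM mulfK // mulf_neq0 ?natf_fact_neq0.
  by field; rewrite !natf_fact_neq0.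
have bD y i : b (y + 1) i = fps_mul (b y) (E 1) i.
  rewrite bE; transitivity (fps_mul inv (fps_mul (E y) (E 1)) i).
    by apply: eq_bigr => k _; rewrite ED.
  by rewrite fps_mulA; apply: eq_bigr => k _; rewrite bE.
have gen : fps_mul (fun i => (0 < i)%:R / i`!%:R) (b x) n.+1 = n`!%:R^-1 * x ^+ n.
  have := congr1 (horner^~ x) (bernoulli_poly_gen K n.+1).
  rewrite hornerZ hornerXn /fps_mul horner_sum => <-.
  by apply: eq_bigr => k _; rewrite hornerM hornerC hornerZ.
have dif : b (x + 1) n.+1 - b x n.+1 = n`!%:R^-1 * x ^+ n.
  rewrite bD fps_mulC -gen /fps_mul big_ord_recl [in RHS]big_ord_recl /=.
  rewrite /E fact0 expr0 divr1 mul1r subn0 !mul0r add0r addrC addKr.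
  by apply: eq_bigr => k _; rewrite expr1n.
move/(congr1 (fun y => n.+1`!%:R * y)): dif.
rewrite mulrBr /b !mulVKf ?natf_fact_neq0 // => ->.
by rewrite factS natrM -mulrA mulVKf ?natf_fact_neq0.
Qed.

(** F(1 - x) - F(x) is periodic, hence constant, and it vanishes at 1/2. *)
Lemma difference_reflect (F : {poly K}) :
  (forall x, F.[- x + 1] - F.[- x] = - (F.[x + 1] - F.[x])) ->
  forall x, F.[1 - x] = F.[x].
Proof.
move=> oddF; pose D := F \Po (1 - 'X) - F.
have DE x : D.[x] = F.[1 - x] - F.[x].
  by rewrite /D hornerD hornerN horner_comp !horner_ops.
have DS x : D.[x + 1] = D.[x].
  rewrite !DE; have := oddF x.
  have -> : 1 - (x + 1) = - x by ring.
  have -> : - x + 1 = 1 - x by ring.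
  move=> /eqP; rewrite subr_eq => /eqP->; ring.
have Dc : D = (D.[1])%:P.
  apply: poly_eq_nat => n; rewrite hornerC.
  by elim: n => // n IHn; rewrite -natr1 DS.
suff D0 : D = 0 by move=> x; apply/eqP; rewrite -subr_eq0 -DE D0 horner0.
have h2 : (2%:R : K) != 0 by rewrite pnatr_eq0.
have : D.[2%:R^-1] = 0.
  by rewrite DE (_ : 1 - 2%:R^-1 = 2%:R^-1) ?subrr //; field.
by rewrite Dc hornerC => ->.
Qed.

(** S_(w,n) is built from this polynomial when n is odd: the two Bernoulli terms
    then enter with the same sign. *)
Definition bernoulli_pair (w n : nat) : {poly K} :=
  n.+1%:R^-1 *: bernoulli_poly K n.+1 + (w - n).+1%:R^-1 *: bernoulli_poly K (w - n).+1.

Lemma bernoulli_pair_difference w n x :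
  (bernoulli_pair w n).[x + 1] - (bernoulli_pair w n).[x] = (palindrome K w n).[x].
Proof.
have := bernoulli_poly_difference n x; have := bernoulli_poly_difference (w - n) x.
rewrite /bernoulli_pair; move: (bernoulli_poly K _) (bernoulli_poly K _) => B' B dB' dB.
rewrite /palindrome !hornerD !hornerZ !hornerXn opprD addrACA -!mulrBr dB dB'.
by rewrite !mulKf ?pnatr_eq0.
Qed.

Lemma bernoulli_pair_reflect w n x : odd n -> ~~ odd w -> (n <= w)%N ->
  (bernoulli_pair w n).[1 - x] = (bernoulli_pair w n).[x].
Proof.
move=> on ew le; apply: difference_reflect => {}x.
rewrite !bernoulli_pair_difference /palindrome !hornerD !hornerXn opprD.
have exprN_odd k : odd k -> (- x) ^+ k = - x ^+ k.
  by move=> ok; rewrite exprNn -signr_odd ok mulN1r.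
by rewrite !exprN_odd // oddB // (negbTE ew) on.
Qed.

Lemma size_bernoulli_pair w n : (0 < n < w)%N -> (size (bernoulli_pair w n) <= w.+1)%N.
Proof.
move=> lt; rewrite (leq_trans (size_polyD _ _)) // geq_max.
have sB c m : (m <= w)%N -> (size (c *: bernoulli_poly K m) <= w.+1)%N.
  move=> le; rewrite (leq_trans (size_scale_leq _ _)) //.
  by rewrite (leq_trans (size_bernoulli_poly _ _)).
by rewrite !sB //; lia.
Qed.

End BernoulliDifference.

Section Evaluation.
Variable K : numFieldType.

Definition point (x y : K) (i : 'I_2) : K := if i == ord0 then x else y.

Definition monomial w i : 'X_{1..2} :=
  [multinom (if j == ord0 then i else w - i)%N | j < 2].

Definition form_coef w (p : {mpoly K[2]}) i : K := p@_(monomial w i).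

Lemma homog_sum w (p : {mpoly K[2]}) : p \is w.-homog ->
  p = \sum_(i < w.+1) form_coef w p i *: 'X_[monomial w i].
Proof.
move=> hp; apply/mpolyP => m; rewrite raddf_sum /=.
have [mw|mw] := eqVneq (mdeg m) w; last first.
  rewrite (dhomog_nemf_coeff hp mw) big1 // => i _; rewrite mcoeffZ mcoeffX.
  case: eqP => [e|]; rewrite ?mulr0 //; case/eqP: mw; rewrite -e mdegE.
  rewrite !big_ord_recl big_ord0 !mnmE /= addn0 subnKC //.
  by rewrite -ltnS.
have lt : (m ord0 < w.+1)%N by rewrite ltnS -mw mdegE !big_ord_recl big_ord0 leq_addr.
have mE : monomial w (m ord0) = m.
  apply/mnmP => j; rewrite mnmE -mw mdegE !big_ord_recl big_ord0 addn0 addKn.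
  by case: eqP => [->//|ne]; congr (m _); apply: val_inj;
    case: j ne => [[|[|]]] //= lt' ne; case: ne; apply: val_inj.
rewrite (bigD1 (Ordinal lt)) //= mcoeffZ mcoeffX mE eqxx mulr1 big1 ?addr0.
  by rewrite /form_coef mE.
move=> i ne; rewrite mcoeffZ mcoeffX; case: eqP => [e|]; rewrite ?mulr0 //.
by case/eqP: ne; apply: val_inj => /=; rewrite -e mnmE eqxx.
Qed.

Lemma homog_eval w (p : {mpoly K[2]}) x y : p \is w.-homog ->
  p.@[point x y] = \sum_(i < w.+1) form_coef w p i * (x ^+ i * y ^+ (w - i)).
Proof.
move=> hp; rewrite [in LHS](homog_sum hp) raddf_sum /=; apply: eq_bigr => i _.
by rewrite mevalZ mevalX !big_ord_recl big_ord0 !mnmE /= mulr1.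
Qed.

(** A binary form is determined by its values at (1, 1), (2, 1), (3, 1) and so
    on; this turns identities of forms into identities between numbers. *)
Lemma homog_eq0 w (p : {mpoly K[2]}) : p \is w.-homog ->
  (forall n : nat, p.@[point n.+1%:R 1] = 0) -> p = 0.
Proof.
move=> hp p0; rewrite (homog_sum hp).
have q0 : \poly_(i < w.+1) form_coef w p i = 0.
  apply: poly_eq0_nat => n; rewrite -[RHS](p0 n) (homog_eval _ _ hp) horner_poly.
  by apply: eq_bigr => i _; rewrite expr1n mulr1.
rewrite big1 // => i _; have := congr1 (fun q : {poly K} => q`_i) q0.
by rewrite coef_poly ltn_ord coef0 => ->; rewrite scale0r.
Qed.

Lemma homog_eq w (p q : {mpoly K[2]}) : p \is w.-homog -> q \is w.-homog ->
  (forall n : nat, p.@[point n.+1%:R 1] = q.@[point n.+1%:R 1]) -> p = q.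
Proof.
move=> hp hq pq; apply/eqP; rewrite -subr_eq0; apply/eqP.
apply: (@homog_eq0 w); first exact: rpredB.
by move=> n; rewrite mevalB pq subrr.
Qed.

Lemma eval_sub2 (p a b : {mpoly K[2]}) v :
  (p \mPo [tuple a; b]).@[v] = p.@[point a.@[v] b.@[v]].
Proof.
rewrite comp_mpoly_meval; apply: meval_eq => i; rewrite /point (tnth_nth 0).
by case: i => [[|[|]]].
Qed.

Lemma eval_h x y : ('X_ord0 : {mpoly K[2]}).@[point x y] = x.
Proof. by rewrite mevalXU. Qed.

Lemma eval_k x y : ('X_ord_max : {mpoly K[2]}).@[point x y] = y.
Proof. by rewrite mevalXU. Qed.

Definition form_eval w (g : dhomog 2 K w) x y : K := (val g).@[point x y].

Lemma mem_Uplus_eval w (g : dhomog 2 K w) :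
    (forall n : nat,
       form_eval g (n.+1%:R + 1) 1 + form_eval g n.+1%:R (n.+1%:R + 1) =
         form_eval g n.+1%:R 1) ->
    (forall n : nat, form_eval g n.+1%:R (-1) = form_eval g n.+1%:R 1) ->
      form_eval g 1 1 = 0 ->
  g \in Uplus K w.
Proof.
move=> g3 gev g11; apply/mem_Uplus; split; last first.
  apply: (@homog_eq w); [exact: (subst_homog (vh K) (- vk K)) | exact: dhomog_is_dhomog |].
  by move=> n; rewrite eval_sub2 mevalN eval_h eval_k; exact: gev.
apply/mem_U; split; last by rewrite -[RHS]g11 /form_eval; apply: meval_eq => i;
  rewrite /point; case: ifP.
apply: (@homog_eq w); last 1 first.
- by move=> n; rewrite mevalD !eval_sub2 mevalD !eval_h !eval_k; exact: g3.
- by apply: rpredD; [exact: (subst_homog (vh K + vk K) (vk K))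
                      | exact: (subst_homog (vh K) (vh K + vk K))].
exact: dhomog_is_dhomog.
Qed.

Lemma form_eval_hw_sub_kw w x y : form_eval (hw_sub_kw K w) x y = x ^+ w - y ^+ w.
Proof. by rewrite /form_eval /= mevalB !rmorphXn /= eval_h eval_k. Qed.

Lemma hw_sub_kw_mem w : ~~ odd w -> hw_sub_kw K w \in Uplus K w.
Proof.
move=> ew; apply: mem_Uplus_eval => [n|n|]; rewrite !form_eval_hw_sub_kw ?expr1n.
- by ring.
- by rewrite -signr_odd (negbTE ew).
- by rewrite subrr.
Qed.

Definition eps_coef w n : K :=
  w.+2%:R / bernoulli K w.+2 * (bernoulli K n.+1 / n.+1%:R)
    * (bernoulli K (w - n).+1 / (w - n).+1%:R).

(** Modulo h^w - k^w, the form S_(w,n) is the antisymmetrization of the form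
    attached to bernoulli_pair. *)
Lemma form_eval_Sform w n x y : odd n -> (0 < n < w)%N -> x != 0 -> y != 0 ->
  form_eval (Sform K w n) x y = y ^+ w * (bernoulli_pair K w n).[x / y]
    - x ^+ w * (bernoulli_pair K w n).[y / x] + eps_coef w n * (x ^+ w - y ^+ w).
Proof.
move=> on lt x0 y0.
have sB m : (m <= w)%N -> (size (bernoulli_poly K m) <= w.+1)%N.
  by move=> le; rewrite (leq_trans (size_bernoulli_poly _ _)).
have hkE m : (m <= w)%N ->
    (homogenize w (bernoulli_poly K m) 'X_ord0 'X_ord_max).@[point x y] =
    (bernoulli_poly K m).[y / x] * x ^+ w.
  by move=> le; rewrite homogenizeE ?eval_h ?eval_k ?sB.
have khE m : (m <= w)%N ->
    (homogenize w (bernoulli_poly K m) 'X_ord_max 'X_ord0).@[point x y] =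
    (bernoulli_poly K m).[x / y] * y ^+ w.
  by move=> le; rewrite homogenizeE ?eval_h ?eval_k ?sB.
have le1 : (n.+1 <= w)%N by lia.
have le2 : ((w - n).+1 <= w)%N by lia.
rewrite /form_eval /= /Spoly /eps on /bernoulli_pair.
move: (hkE _ le1) (hkE _ le2) (khE _ le1) (khE _ le2).
move: (homogenize _ _ _ _) (homogenize _ _ _ _) (homogenize _ _ _ _) (homogenize _ _ _ _).
move: (bernoulli_poly K _) (bernoulli_poly K _) => B' B H1 H2 H3 H4 E1 E2 E3 E4.
rewrite mevalD !mevalB mevalD !mevalZ mevalB !rmorphXn /= eval_h eval_k.
rewrite !hornerD !hornerZ -signr_odd on expr1.
rewrite E1 E2 E3 E4 -/(eps_coef w n); move: (eps_coef w n) => e.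
move: (n.+1%:R^-1) ((w - n).+1%:R^-1) => a b.
by ring.
Qed.

(** In g(h + k, k) + g(h, h + k) the values of F at h/(h + k) and k/(h + k)
    cancel by reflection, and the difference equation at h/k and k/h leaves g
    plus two opposite palindromic terms; evenness follows in the same way. *)
Lemma Sform_mem w n : ~~ odd w -> odd n -> (0 < n < w)%N -> Sform K w n \in Uplus K w.
Proof.
move=> ew on lt; have S_E x y := @form_eval_Sform w n x y on lt.
have dF := @bernoulli_pair_difference K w n.
have rF x := @bernoulli_pair_reflect K w n x on ew.
have lenw : (n <= w)%N by lia.
have o1 : (1 : K) != 0 by exact: oner_neq0.
set F := bernoulli_pair K w n in S_E dF rF.
have pal x : x != 0 -> x ^+ w * (palindrome K w n).[x^-1] = (palindrome K w n).[x].
  move=> x0; rewrite /palindrome !hornerD !hornerXn mulrDr addrC.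
  rewrite -[in LHS](subnK lenw) exprD addnK !exprVn mulfK ?expf_neq0 //.
  by rewrite mulrAC divff ?mul1r ?expf_neq0.
apply: mem_Uplus_eval => [i|i|]; last by rewrite S_E // !divr1 !expr1n !subrr mulr0 addr0.
  set x : K := i.+1%:R; have x0 : x != 0 by exact: natS_neq0.
  have x1 : x + 1 != 0 by rewrite /x natr1 natS_neq0.
  rewrite !S_E // !divr1 !expr1n !mul1r.
  have -> : F.[x / (x + 1)] = F.[(x + 1)^-1].
    rewrite -rF //; congr (F.[_]); move: x1; clearbody x => x1; field; exact: x1.
  have := dF x; have := dF x^-1; have := pal x x0.
  have -> : (x + 1) / x = x^-1 + 1 by rewrite mulrDl divff // mul1r addrC.
  move=> <- /eqP; rewrite subr_eq => /eqP-> /eqP; rewrite subr_eq => /eqP->.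
  by ring.
set x : K := i.+1%:R; have x0 : x != 0 by exact: natS_neq0.
rewrite !S_E ?oppr_eq0 // invrN invr1 mulrN1 mulr1 mulN1r !mul1r.
rewrite -signr_odd (negbTE ew) expr0 expr1n.
have FN y : F.[- y] = F.[y] + (palindrome K w n).[y].
  by rewrite -dF addrC subrK -[LHS]rF // opprK addrC.
rewrite !FN -[in X in X - _]pal //.
by ring.
Qed.

End Evaluation.

(** * Even antisymmetric forms and the S3-antisymmetrizer *)

Section EvenAntisymmetric.
Variables (K : numFieldType) (m : nat).
Local Notation w := (2 * m)%N.

(** The third identity replaces the three-term relation by one that is visibly
    the vanishing of an S3-antisymmetrization. *)
Lemma Uplus_eval (g : dhomog 2 K w) : g \in Uplus K w ->
  [/\ forall x y, form_eval g x (- y) = form_eval g x y,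
      forall x y, form_eval g y x = - form_eval g x y &
      forall x y, form_eval g x y + form_eval g y (- x - y) + form_eval g (- x - y) x = 0].
Proof.
move=> /mem_Uplus[/mem_U[g3 _] gev].
have E3 x y : form_eval g (x + y) y + form_eval g x (x + y) = form_eval g x y.
  by have := congr1 (meval (point x y)) g3;
     rewrite mevalD !eval_sub2 mevalD !eval_h !eval_k.
have EE x y : form_eval g x (- y) = form_eval g x y.
  by have := congr1 (meval (point x y)) gev; rewrite eval_sub2 mevalN eval_h eval_k.
(* The three-term relation at (x + y, - y). *)
have E4 x y : form_eval g x y + form_eval g (x + y) x = form_eval g (x + y) y.
  by have := E3 (x + y) (- y); rewrite addrK !EE.
have anti x y : form_eval g y x = - form_eval g x y.
  have := E3 y (x - y); have := E4 y (x - y).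
  have -> : y + (x - y) = x by ring.
  move=> <- /eqP; rewrite -addrA -subr_eq0 addrAC subrr add0r addrC addr_eq0.
  by move/eqP.
split=> // x y.
have -> : - x - y = - (x + y) by ring.
rewrite EE [form_eval g (- _) x]anti EE -anti -[X in X + _ + _]E3.
by rewrite [form_eval g (x + y) y]anti [form_eval g (x + y) x]anti; ring.
Qed.

Lemma big_fold_half (b : nat -> K) : (forall j, (2 * j = m)%N -> b j = 0) ->
  \sum_(j < m.+1) b j = \sum_(j < m.+1./2) (b j + b (m - j)%N).
Proof.
move=> mid; pose N := m.+1./2.
rewrite big_split /= -!(big_mkord xpredT).
rewrite (@big_cat_nat _ _ _ N) //=; last by rewrite /N; lia.
congr (_ + _).
rewrite (@big_cat_nat _ _ _ (m.+1 - N)) //=; try by rewrite /N; lia.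
rewrite [X in X + _]big_nat [X in X + _]big1 ?add0r; last first.
  by move=> i lti; apply: mid; rewrite /N in lti; lia.
rewrite big_nat_rev /= -{1}[(m.+1 - N)%N]add0n big_addn.
have -> : (m.+1 - (m.+1 - N) = N)%N by rewrite /N; lia.
rewrite big_mkord; apply: eq_bigr => -[i /= lti] _; congr b.
by move: lti; rewrite /N; lia.
Qed.

Lemma Uplus_coef (g : dhomog 2 K w) i : g \in Uplus K w -> (i <= w)%N ->
  (odd i -> form_coef w (val g) i = 0) /\
  form_coef w (val g) (w - i) = - form_coef w (val g) i.
Proof.
move=> /Uplus_eval[gE gA _] lei; pose a := form_coef w (val g).
have hg := dhomog_is_dhomog g.
pose q := \poly_(j < w.+1) a j.
have qE x : q.[x] = form_eval g x 1.
  by rewrite horner_poly /form_eval (homog_eval _ _ hg); apply: eq_bigr => j _;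
    rewrite expr1n mulr1.
have coefE (p : {poly K}) : q = p -> a i = p`_i.
  by move=> <-; rewrite coef_poly ltnS lei.
split.
  move=> oi; have := coefE (\poly_(j < w.+1) ((-1) ^+ (w - j) * a j)) _.
  have owi : odd (w - i) by rewrite oddB // oi [in odd _]mul2n odd_double.
  rewrite coef_poly ltnS lei -signr_odd owi expr1 mulN1r => aE.
  suff /eqP : a i = - a i by rewrite -addr_eq0 -mulr2n mulrn_eq0 => /eqP.
  apply: aE; apply: poly_eq_nat => n; rewrite qE -gE horner_poly.
  rewrite /form_eval (homog_eval _ _ hg).
  by apply: eq_bigr => j _; rewrite -/(a j); ring.
change (a (w - i)%N = - a i).
have := coefE (\poly_(j < w.+1) (- a (w - j)%N)) _.
rewrite coef_poly ltnS lei => -> //; first by rewrite opprK.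
apply: poly_eq_nat => n; rewrite qE gA horner_poly /form_eval (homog_eval _ _ hg).
rewrite -sumrN (reindex_inj rev_ord_inj) /=; apply: eq_bigr => j _.
have lej : (j <= w)%N by rewrite -ltnS.
by rewrite subSS subKn // expr1n mul1r mulNr.
Qed.

(** Evenness and antisymmetry leave the coefficients of x^(2j) y^(w-2j) with
    2j < m as coordinates. *)
Lemma Uplus_half_sum (g : dhomog 2 K w) x y : g \in Uplus K w ->
  form_eval g x y = \sum_(j < m.+1./2) form_coef w (val g) (2 * j) *
    (x ^+ (2 * j) * y ^+ (w - 2 * j) - y ^+ (2 * j) * x ^+ (w - 2 * j)).
Proof.
move=> gU; have cf i := @Uplus_coef g i gU.
set a := form_coef w (val g) in cf *.
rewrite /form_eval (homog_eval _ _ (dhomog_is_dhomog g)) -/a.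
pose b j := a (2 * j)%N * (x ^+ (2 * j) * y ^+ (w - 2 * j)).
transitivity (\sum_(j < m.+1) b j).
  pose G e := if (e <= w)%N then a e * (x ^+ e * y ^+ (w - e)) else 0.
  transitivity (\sum_(e < 2 * m.+1) G e).
    rewrite mulnS addSn add1n [RHS]big_ord_recr /= /G ltnn addr0.
    by apply: eq_bigr => i _; rewrite -ltnS ltn_ord.
  rewrite big_even_odd; apply: eq_bigr => l _; have := ltn_ord l => ltl.
  rewrite /G (_ : (2 * l <= w)%N); last by lia.
  rewrite [X in _ + X](_ : _ = 0) ?addr0 //; case: ifP => // lel.
  by rewrite (proj1 (cf _ _)) ?mul0r //= mul2n odd_double.
rewrite big_fold_half => [|j jm]; last first.
  suff /eqP : a (2 * j)%N = - a (2 * j)%N.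
    by rewrite -addr_eq0 -mulr2n mulrn_eq0 /b => /eqP ->; rewrite mul0r.
  by rewrite -(proj2 (cf _ _)); [congr a|]; lia.
apply: eq_bigr => -[j /= ltj] _; rewrite /b.
have -> : (2 * (m - j) = w - 2 * j)%N by lia.
rewrite (proj2 (cf _ _)); last by lia.
by rewrite subKn; [ring | lia].
Qed.

End EvenAntisymmetric.

Section S3Antisymmetrizer.
Variables (K : numFieldType) (m : nat).
Local Notation w := (2 * m)%N.

(** The S3-antisymmetrization of f, written on the plane x + y + z = 0. *)
Definition alternate (A : zmodType) (B : Type) (f : B -> B -> A) (x y z : B) : A :=
  f x y + f y z + f z x - f y x - f z y - f x z.

Definition alt_monomial i : {poly K} :=
  alternate (fun u v => u ^+ i * v ^+ (w - i)) 'X 1 (- 1 - 'X).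

Definition coef_functional (c : nat -> K) (p : {poly K}) : K := \sum_(i < w.+1) p`_i * c i.

Lemma coef_functional_sum c (I : finType) (a : I -> K) (p : I -> {poly K}) :
  coef_functional c (\sum_i a i *: p i) = \sum_i a i * coef_functional c (p i).
Proof.
rewrite /coef_functional; under eq_bigr do rewrite coef_sum mulr_suml.
rewrite exchange_big; apply: eq_bigr => i _; rewrite mulr_sumr.
by apply: eq_bigr => j _; rewrite coefZ mulrA.
Qed.

(** The antisymmetrizer restricted to even antisymmetric forms already has the
    full image: a functional that kills its values there kills all its
    values.  By the powers (l u + v)^w this becomes a statement about one
    polynomial P in l. *)
Lemma coef_functional_alternate c :
    (forall j, (2 * j < m)%N -> coef_functional c (alt_monomial (2 * j)) = 0) ->
  forall i, (i <= w)%N -> coef_functional c (alt_monomial i) = 0.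
Proof.
move=> c0.
have altN i : (i <= w)%N -> alt_monomial (w - i) = - alt_monomial i.
  by move=> lei; rewrite /alt_monomial /alternate subKn //; ring.
have funN p : coef_functional c (- p) = - coef_functional c p.
  by rewrite /coef_functional -sumrN; apply: eq_bigr => i _; rewrite coefN mulNr.
have even0 i : (i <= w)%N -> ~~ odd i -> coef_functional c (alt_monomial i) = 0.
  move=> lei ei; case: (ltngtP i m) => h.
  - by have := c0 i./2; rewrite (_ : (2 * i./2 = i)%N); [apply; lia | lia].
  - apply/eqP; rewrite -oppr_eq0 -funN -altN //.
    by have := c0 (w - i)./2; rewrite (_ : (2 * (w - i)./2 = w - i)%N) => [->//|]; lia.
  - have e : alt_monomial i = - alt_monomial i by rewrite -altN //; congr alt_monomial; lia.
    apply/eqP; have /eqP := congr1 (coef_functional c) e.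
    by rewrite funN -addr_eq0 -mulr2n mulrn_eq0.
pose P := \poly_(i < w.+1) ('C(w, i)%:R * coef_functional c (alt_monomial i)).
pose pow (l : K) : {poly K} := alternate (fun u v => (l%:P * u + v) ^+ w) 'X 1 (- 1 - 'X).
have powE l : P.[l] = coef_functional c (pow l).
  transitivity (coef_functional c (\sum_(i < w.+1) ('C(w,
    i)%:R * l ^+ i) *: alt_monomial i)).
    rewrite coef_functional_sum horner_poly; apply: eq_bigr => i _; ring.
  congr coef_functional; rewrite /pow /alternate.
  have bin u v : (l%:P * u + v : {poly K}) ^+ w =
      \sum_(i < w.+1) ('C(w, i)%:R * l ^+ i) *: (u ^+ i * v ^+ (w - i)).
    rewrite addrC exprDn; apply: eq_bigr => i _.
    rewrite exprMn -mul_polyC polyCM polyC_natr polyC_exp -mulr_natl; ring.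
  rewrite !bin -!sumrN -!big_split /=; apply: eq_bigr => i _.
  by rewrite -!scalerN -!scalerDr.
(* On u + v + t = 0 one has (1 - l) u + v = - (l u + t). *)
have pow_refl l : pow (1 - l) = - pow l.
  have fl (u v t : {poly K}) : u + v + t = 0 -> ((1 - l)%:P * u + v) ^+ w =
    (l%:P * u + t) ^+ w.
    move=> uvt; have -> : (1 - l)%:P * u + v = - (l%:P * u + t).
      by rewrite polyCB; apply/eqP; rewrite -subr_eq0 -uvt; apply/eqP; ring.
    by rewrite exprNn mul2n -addnn exprD -expr2 sqrr_sign mul1r.
  rewrite /pow /alternate.
  rewrite (fl 'X 1 (-1 - 'X)); last by ring.
  rewrite (fl 1 (-1 - 'X) 'X); last by ring.
  rewrite (fl (-1 - 'X) 'X 1); last by ring.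
  rewrite (fl 1 'X (-1 - 'X)); last by ring.
  rewrite (fl (-1 - 'X) 1 'X); last by ring.
  rewrite (fl 'X (-1 - 'X) 1); last by ring.
  by ring.
have Podd l : P.[- l] = - P.[l].
  rewrite !horner_poly -sumrN; apply: eq_bigr => i _.
  have lei : (i <= w)%N by rewrite -ltnS.
  have [oi|ei] := boolP (odd i); last by rewrite even0 // mulr0 !mul0r oppr0.
  by rewrite exprNn -signr_odd oi expr1 mulN1r mulrN.
have PS l : P.[l + 1] = P.[l].
  by rewrite -[RHS]opprK -Podd !powE -funN -pow_refl opprK addrC.
have P0 : P = 0.
  apply: poly_eq0_nat; elim=> [|n IHn]; last by rewrite -natr1 PS.
  rewrite -[1]add0r PS horner_coef0 coef_poly /=.
  by rewrite even0 ?mulr0.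
move=> i lei; have := congr1 (fun p : {poly K} => p`_i) P0.
rewrite coef_poly ltnS lei coef0 => /eqP.
rewrite mulf_eq0 pnatr_eq0 -leqn0 leqNgt bin_gt0 lei.
by move/eqP.
Qed.

End S3Antisymmetrizer.

(** * The dimension of the space of even period polynomials *)

Section DimensionBound.
Variables (K : numFieldType) (m : nat).
Local Notation w := (2 * m)%N.

(** The Vandermonde product times (xyz)^(2b+1) times a power of
    x^2 + xy + y^2: of even degree, so that xyz occurs to an odd power, and
    vanishing to the exact order 2b + 1 at x = 0. *)
Definition alt_val b (A : comPzRingType) (x y z : A) : A :=
  (x - y) * (y - z) * (z - x) * (x * y * z) ^+ (2 * b).+1 *
  (x ^+ 2 + x * y + y ^+ 2) ^+ (m - 3 * b.+1).

Definition alt_poly b : {poly K} := alt_val b 'X 1 (- 1 - 'X).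

Lemma horner_alt_poly b x : (alt_poly b).[x] = alt_val b x 1 (- 1 - x).
Proof. by rewrite /alt_poly /alt_val !horner_ops. Qed.

Lemma alt_val_hom b (u v : K) : (3 * b.+1 <= m)%N -> v != 0 ->
  v ^+ w * (alt_poly b).[u / v] = alt_val b u v (- u - v).
Proof.
move=> leb v0; rewrite horner_alt_poly /alt_val.
have -> : w = (3 + (3 * (2 * b).+1 + 2 * (m - 3 * b.+1)))%N by lia.
rewrite (exprD v 3) (exprD v (3 * _)) (exprM v 3) (exprM v 2).
(* Distributing v^w over the three factors, of degrees 3, 3 and 2. *)
have gen (a1 a2 a3 A B C : K) i j : a1 * (a2 ^+ i * a3 ^+ j) * (A * B ^+ i * C ^+ j) =
    (a1 * A) * (a2 * B) ^+ i * (a3 * C) ^+ j.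
  rewrite !exprMn; move: (a2 ^+ i) (a3 ^+ j) (B ^+ i) (C ^+ j) => p q r s.
  by ring.
by rewrite gen; congr (_ * _ ^+ _ * _ ^+ _); field.
Qed.

Lemma size_alt_poly b : (3 * b.+1 <= m)%N -> (size (alt_poly b) <= w.+1)%N.
Proof.
move=> leb; rewrite /alt_poly /alt_val.
have s1 (p q : {poly K}) i j : (size p <= i.+1 -> size q <= j.+1 ->
  size (p * q)%R <= (i + j).+1)%N.
  by move=> sp sq; rewrite (leq_trans (size_polyMleq _ _)) //; lia.
have sE (p : {poly K}) i e : (size p <= i.+1 -> size (p ^+ e)%R <= (i * e).+1)%N.
  move=> sp; rewrite (leq_trans (size_poly_exp_leq _ _)) // ltnS leq_mul2r.
  by rewrite -subn1 leq_subLR add1n sp orbT.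
have lin (c d : K) : (size (c *: 'X + d%:P)%R <= 2)%N.
  rewrite (leq_trans (size_polyD _ _)) // geq_max (leq_trans (size_polyC_leq1 _)) // andbT.
  by rewrite (leq_trans (size_scale_leq _ _)) // size_polyX.
have l1 : (size ('X - 1 : {poly K})%R <= 2)%N.
  by have := lin 1 (-1); rewrite scale1r polyCN.
have l2 : (size (1 - (- 1 - 'X) : {poly K})%R <= 2)%N.
  by have := lin 1 2%:R; rewrite scale1r polyC_natr (_ : 'X + 2%:R =
    1 - (- 1 - 'X)) //; ring.
have l3 : (size (- 1 - 'X - 'X : {poly K})%R <= 2)%N.
  have := lin (- 2%:R) (- 1); rewrite polyCN -mul_polyC polyCN polyC_natr.
  by rewrite (_ : - 2%:R * 'X + - 1%:P = - 1 - 'X - 'X) //; ring.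
have l4 : (size ('X * 1 * (- 1 - 'X) : {poly K})%R <= 3)%N.
  apply: (s1 _ _ 1%N 1%N); first by rewrite mulr1 size_polyX.
  by have := lin (- 1) (- 1); rewrite scaleN1r polyCN addrC.
have l5 : (size ('X ^+ 2 + 'X * 1 + 1 ^+ 2 : {poly K})%R <= 3)%N.
  rewrite mulr1 expr1n -addrA (leq_trans (size_polyD _ _)) // geq_max size_polyXn.
  by have := lin 1 1; rewrite scale1r => /leq_trans ->.
have := s1 _ _ _ _ (s1 _ _ _ _ (s1 _ _ _ _ (s1 _ _ _ _ l1 l2) l3) (sE _ _ (2 * b).+1 l4))
  (sE _ _ (m - 3 * b.+1)%N l5).
by move/leq_trans; apply; lia.
Qed.

Lemma coef_alt_poly_lt b i : (i < (2 * b).+1)%N -> (alt_poly b)`_i = 0.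
Proof.
move=> lti; rewrite /alt_poly /alt_val mulr1 exprMn.
by rewrite mulrCA -mulrA -mulrA coefXnM lti.
Qed.

Lemma coef_alt_poly_eq b : (alt_poly b)`_(2 * b).+1 = - 2%:R.
Proof.
rewrite /alt_poly /alt_val mulr1 exprMn.
rewrite mulrCA -mulrA -mulrA coefXnM ltnn subnn -horner_coef0 !horner_ops.
have -> : 0 * 0 + 0 + 1 * 1 = 1 :> K by ring.
have -> : (-1 - 0) ^+ (2 * b).+1 = -1 :> K.
  by rewrite subr0 -signr_odd /= mul2n odd_double.
by rewrite expr1n; ring.
Qed.

(** The antisymmetrizer multiplies an alternating form by the order of S3. *)
Lemma alt_poly_alternates b : (3 * b.+1 <= m)%N ->
  \sum_(i < w.+1) (alt_poly b)`_i *: alt_monomial K m i = 6%:R *: alt_poly b.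
Proof.
move=> leb; apply: poly_eq_nat => n; set x : K := n.+1%:R.
have x0 : x != 0 by exact: natS_neq0.
have z0 : - 1 - x != 0 by rewrite -opprD oppr_eq0 /x -[1]/(1%:R) -natrD natS_neq0.
have homE u v : v != 0 -> \sum_(i < w.+1) (alt_poly b)`_i * (u ^+ i * v ^+ (w - i)) =
    alt_val b u v (- u - v).
  move=> v0; rewrite -alt_val_hom // (horner_coef_wide _ (size_alt_poly leb)) mulr_sumr.
  apply: eq_bigr => i _; rewrite [RHS]mulrCA; congr (_ * _).
  have lei : (i <= w)%N by rewrite -ltnS.
  have -> : v ^+ w = v ^+ (w - i) * v ^+ i by rewrite -exprD subnK.
  by rewrite exprMn exprVn mulrACA divff ?expf_neq0 // mulr1 mulrC.
rewrite horner_sum hornerZ horner_alt_poly.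
transitivity (alternate (fun u v => alt_val b u v (- u - v)) x 1 (- 1 - x)).
  rewrite /alternate -!homE ?oner_neq0 // -!sumrN -!big_split /=; apply: eq_bigr => i _.
  rewrite hornerZ /alt_monomial /alternate !horner_ops; ring.
rewrite /alternate.
have -> : - x - 1 = - 1 - x by ring.
have -> : - 1 - (- 1 - x) = x by ring.
have -> : - (- 1 - x) - x = 1 by ring.
have -> : - (- 1 - x) - 1 = x by ring.
have -> : - x - (- 1 - x) = 1 by ring.
have even_perm (u v t u' v' t' : K) :
    (u' - v') * (v' - t') * (t' - u') = (u - v) * (v - t) * (t - u) ->
    u' * v' * t' = u * v * t -> u' ^+ 2 + u' * v' + v' ^+ 2 = u ^+ 2 + u * v + v ^+ 2 ->
  alt_val b u' v' t' = alt_val b u v t by rewrite /alt_val => -> -> ->.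
have odd_perm (u v t u' v' t' : K) :
    (u' - v') * (v' - t') * (t' - u') = - ((u - v) * (v - t) * (t - u)) ->
    u' * v' * t' = u * v * t -> u' ^+ 2 + u' * v' + v' ^+ 2 = u ^+ 2 + u * v + v ^+ 2 ->
  alt_val b u' v' t' = - alt_val b u v t by rewrite /alt_val => -> -> ->; rewrite !mulNr.
rewrite (even_perm x 1 (- 1 - x) 1 (- 1 - x) x); try by ring.
rewrite (even_perm x 1 (- 1 - x) (- 1 - x) x 1); try by ring.
rewrite (odd_perm x 1 (- 1 - x) 1 x (- 1 - x)); try by ring.
rewrite (odd_perm x 1 (- 1 - x) (- 1 - x) 1 x); try by ring.
rewrite (odd_perm x 1 (- 1 - x) x (- 1 - x) 1); by ring.
Qed.

Lemma alt_poly_free (u : 'I_(m %/ 3) -> K) :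
  (forall i, (i <= w)%N -> (\sum_b u b *: alt_poly b)`_i = 0) -> forall b, u b = 0.
Proof.
move=> u0 b; have [n] := ubnP b; elim: n b => // n IHn b /ltnSE leb.
have := u0 (2 * b).+1; rewrite coef_sum (bigD1 b) //= big1 ?addr0.
  rewrite coefZ coef_alt_poly_eq => /(_ _)/eqP; rewrite mulf_eq0 oppr_eq0 pnatr_eq0 orbF.
  by move=> h; apply/eqP/h; have := ltn_ord b; lia.
move=> i ne; rewrite coefZ; case: (ltngtP i b) => h.
- by rewrite IHn ?mul0r // (leq_trans h).
- by rewrite coef_alt_poly_lt ?mulr0 //; lia.
- by case/eqP: ne; apply: val_inj.
Qed.

Definition alt_matrix : 'M[K]_(m.+1./2, w.+1) :=
  \matrix_(j, i) (alt_monomial K m (2 * j))`_i.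

(** The rows alt_poly b are independent and, by duality, lie in the row space
    of the matrix: its cokernel consists of functionals that kill the
    antisymmetrizations of even antisymmetric forms. *)
Lemma alt_matrix_rank : (m %/ 3 <= \rank alt_matrix)%N.
Proof.
pose F : 'M[K]_(m %/ 3, w.+1) := \matrix_(b, i) (alt_poly b)`_i.
have freeF : row_free F.
  apply: inj_row_free => u uF; apply/rowP => b; rewrite mxE; move: b.
  apply: alt_poly_free => i lei.
  have /rowP/(_ (Ordinal (lei : (i < w.+1)%N))) := uF; rewrite !mxE => uE; rewrite -[RHS]uE.
  by rewrite coef_sum; apply: eq_bigr => b _; rewrite coefZ !mxE.
have : (F <= alt_matrix)%MS.
  rewrite submxE; apply/eqP/matrixP => b c; rewrite [RHS]mxE.
  pose C i : K := if insub i is Some i' then cokermx alt_matrix i' c else 0.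
  have funE (p : {poly K}) : coef_functional m C p =
    \sum_(i < w.+1) p`_i * cokermx alt_matrix i c.
    by apply: eq_bigr => i _; rewrite /C valK.
  have C0 i : (i <= w)%N -> coef_functional m C (alt_monomial K m i) = 0.
    apply: coef_functional_alternate => j ltj.
    have ltj' : (j < m.+1./2)%N by lia.
    have /matrixP/(_ (Ordinal ltj') c) := mulmx_coker alt_matrix;
      rewrite funE mxE [RHS]mxE => e; rewrite -[RHS]e.
    by apply: eq_bigr => i' _; rewrite [alt_matrix _ _]mxE.
  have leb : (3 * b.+1 <= m)%N by have := ltn_ord b; lia.
  have : coef_functional m C (6%:R *: alt_poly b) = 0.
    rewrite -alt_poly_alternates // (coef_functional_sum m C (fun i : 'I_w.+1 =>
      (alt_poly b)`_i)).
    by rewrite big1 // => i _; rewrite C0 ?mulr0 // -ltnS.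
  rewrite funE; under eq_bigr do rewrite coefZ -mulrA.
  rewrite -mulr_sumr => /eqP; rewrite mulf_eq0 pnatr_eq0 /= => /eqP e.
  by rewrite mxE -[RHS]e; apply: eq_bigr => i _; rewrite [F _ _]mxE.
by move/mxrankS; rewrite (eqP freeF).
Qed.

Lemma dim_Uplus_le : (\dim (Uplus K w) <= m.+1./2 - m %/ 3)%N.
Proof.
set U := Uplus K w; pose X := vbasis U.
pose G : 'M[K]_(\dim U, m.+1./2) := \matrix_(r, j) form_coef w (val X`_r) (2 * j).
have XU r : (r < \dim U)%N -> X`_r \in U.
  by move=> ltr; apply: vbasis_mem; rewrite mem_nth // size_tuple.
have freeG : row_free G.
  apply: inj_row_free => u uG; apply/rowP => r; rewrite mxE; move: r.
  have /freeP fX := basis_free (vbasisP U); apply: (fX (fun i => u 0 i)).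
  pose g := \sum_(i < \dim U) u 0 i *: X`_i.
  have gU : g \in U by apply: rpred_sum => i _; apply: rpredZ; apply: XU.
  apply: val_inj; apply: (homog_eq0 (dhomog_is_dhomog g)) => n.
  rewrite -/(form_eval g _ _) Uplus_half_sum // big1 // => j _.
  suff -> : form_coef w (val g) (2 * j) = 0 by rewrite mul0r.
  have /rowP/(_ j) := uG; rewrite !mxE => e; rewrite -[RHS]e.
  rewrite /form_coef raddf_sum raddf_sum /=; apply: eq_bigr => i _.
  by rewrite !mxE /form_coef mcoeffZ.
have GM : G *m alt_matrix = 0.
  apply/matrixP => r i; rewrite !mxE.
  set g := X`_r; have gU : g \in U by apply: XU.
  have [_ _ cyc] := Uplus_eval gU.
  transitivity ((\sum_(j < m.+1./2) form_coef w (val g) (2 * j) *: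
    alt_monomial K m (2 * j))`_i).
    by rewrite coef_sum; apply: eq_bigr => j _; rewrite coefZ !mxE.
  rewrite (_ : \sum_(j < m.+1./2) _ = 0) ?coef0 //.
  apply: poly_eq0_nat => n; set x : K := n.+1%:R.
  have := cyc x 1; have -> : - x - 1 = - 1 - x by ring.
  rewrite !(Uplus_half_sum _ _ gU) -!big_split horner_sum /= => e; rewrite -[RHS]e.
  apply: eq_bigr => j _; rewrite hornerZ -!mulrDr; congr (_ * _).
  by rewrite /alt_monomial /alternate !horner_ops; ring.
have := mulmx0_rank_max GM; rewrite (eqP freeG); have := alt_matrix_rank.
by lia.
Qed.

End DimensionBound.

(** * The basis *)

Section Basis.
Variable K : numFieldType.

(** The indices stay below w/2, so n_i and w - n_j never coincide. *)
Lemma four_pm1_bounds w i : (0 < i <= d_ w)%N -> ~~ odd w ->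
  [/\ odd (four_pm1 w i), (0 < four_pm1 w i)%N & (2 * four_pm1 w i < w)%N].
Proof.
rewrite /four_pm1 /d_ => /andP[i0 lei] ew.
case: ifP => h4; case: ifP lei => h12 lei; split; lia.
Qed.

Lemma form_eval_comb w d (k : 'I_d -> K) (g : 'I_d -> dhomog 2 K w) c v x y :
  form_eval (\sum_i k i *: g i + c *: v) x y =
    \sum_i k i * form_eval (g i) x y + c * form_eval v x y.
Proof.
have evD (a b : dhomog 2 K w) : form_eval (a + b) x y =
  form_eval a x y + form_eval b x y by exact: mevalD.
have evZ a (b : dhomog 2 K w) : form_eval (a *: b) x y =
  a * form_eval b x y by exact: mevalZ.
have form_eval0 : form_eval (0 : dhomog 2 K w) x y = 0 by exact: meval0.
rewrite evD evZ (big_morph (fun a => form_eval a x y) evD form_eval0); congr (_ + _).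
by apply: eq_bigr.
Qed.

Lemma form_eval0 w x y : form_eval (0 : dhomog 2 K w) x y = 0.
Proof. exact: meval0. Qed.

(** At the points (x, 1) the relation says that F(x) - x^w F(1/x) is a multiple
    of x^w - 1; subtracting a constant C from F makes it palindromic. *)
Lemma Sform_relation m d (J : 'I_d -> nat) (k : 'I_d -> K) c :
    (0 < m)%N -> injective J -> (forall i, (2 * J i < m.-1)%N) ->
    (d + S3_dim m <= m.+1./2)%N ->
    \sum_i k i *: Sform K (2 * m) (2 * J i).+1 + c *: hw_sub_kw K (2 * m) = 0 ->
  (forall i, k i = 0) /\ c = 0.
Proof.
move=> m0 injJ ltJ led rel; set w := (2 * m)%N in rel *.
have oJ i : odd (2 * J i).+1 by rewrite /= mul2n odd_double.
have bJ i : (0 < (2 * J i).+1 < w)%N by have := ltJ i; rewrite /w; lia.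
have ew : ~~ odd w by rewrite /w mul2n odd_double.
pose C := \sum_i k i * eps_coef K w (2 * J i).+1 + c.
pose F0 := \sum_i k i *: bernoulli_pair K w (2 * J i).+1.
have k0 : forall i, k i = 0.
  apply: (difference_independent (F := F0 - C%:P) injJ ltJ led).
  - rewrite (leq_trans (size_polyD _ _)) // geq_max size_polyN; apply/andP; split.
      apply: (leq_trans (size_sum _ _ _)); apply/bigmax_leqP => i _.
      by rewrite (leq_trans (size_scale_leq _ _)) // size_bernoulli_pair.
    by rewrite (leq_trans (size_polyC_leq1 _)).
  - move=> x; rewrite !hornerD !hornerN !hornerC opprB addrA addrNK.
    rewrite /F0 !horner_sum -sumrB; apply: eq_bigr => i _.
    by rewrite !hornerZ -mulrBr bernoulli_pair_difference.
  - move=> x; rewrite !hornerD !hornerN !hornerC /F0 !horner_sum; congr (_ - _).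
    apply: eq_bigr => i _; rewrite !hornerZ bernoulli_pair_reflect //.
    by have := bJ i; lia.
  - move=> x x0; have := form_eval_comb k (fun i =>
    Sform K w (2 * J i).+1) c (hw_sub_kw K w) x 1.
    rewrite rel form_eval0 form_eval_hw_sub_kw expr1n.
    have -> : \sum_i k i * form_eval (Sform K w (2 * J i).+1) x 1 =
      F0.[x] - x ^+ w * F0.[x^-1] + (C - c) * (x ^+ w - 1).
      rewrite /F0 !horner_sum /C addrK mulr_sumr mulr_suml -sumrN -!big_split /=.
      apply: eq_bigr => i _; rewrite form_eval_Sform ?oner_neq0 //.
      rewrite !hornerZ divr1 expr1n div1r.
      by ring.
    rewrite !hornerD !hornerN !hornerC => e.
    apply/eqP; rewrite -subr_eq0 -oppr_eq0; apply/eqP; rewrite [RHS]e; ring.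
split=> //.
move: rel; rewrite big1 ?add0r => [|i _]; last by rewrite k0 scale0r.
move/(congr1 (fun g => form_eval g 1 0)); rewrite form_eval0 {1}/form_eval /= mevalZ.
rewrite -/(form_eval (hw_sub_kw K w) 1 0) form_eval_hw_sub_kw expr1n expr0n.
by rewrite (_ : (w == 0)%N = false) ?subr0 ?mulr1 //; rewrite /w; lia.
Qed.
Lemma Uplus_basis w : (0 < w)%N -> ~~ odd w ->
  basis_of (Uplus K w)
    (rcons [seq Sform K w (four_pm1 w i) | i <- iota 1 (d_ w)] (hw_sub_kw K w)).
Proof.
move=> w0 ew; have [m wE] : exists m, w = (2 * m)%N by exists w./2; lia.
have bnd i := @four_pm1_bounds w i.
rewrite basisEfree; apply/and3P; split.
- pose J (i : 'I_(d_ w)) := (four_pm1 w i.+1)./2.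
  have JE (i : 'I_(d_ w)) : four_pm1 w i.+1 = (2 * J i).+1.
    have [|o _ _] := bnd i.+1 _ ew; first by rewrite ltn_ord.
    by rewrite /J; lia.
  apply/(@freeP _ _ (d_ w).+1 [tuple of rcons
      [seq Sform K w (four_pm1 w i) | i <- iota 1 (d_ w)] (hw_sub_kw K w)]) => k.
  rewrite big_ord_recr /= nth_rcons size_map size_iota ltnn eqxx => rel.
  have [|||||k0 kd0] := @Sform_relation m (d_ w) J
      (fun i => k (widen_ord (leqnSn _) i)) (k ord_max).
  + by lia.
  + move=> i j e; apply: val_inj.
    have : four_pm1 w i.+1 = four_pm1 w j.+1 by rewrite !JE e.
    by rewrite /four_pm1; case: ifP => _ /=; lia.
  + move=> i; have [|o p lt] := bnd i.+1 _ ew; first by rewrite ltn_ord.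
    by move: lt; rewrite JE; lia.
  + by move: w0 ew; rewrite wE /d_ /S3_dim; case: ifP; lia.
  + rewrite -wE -[RHS]rel; congr (_ + _); apply: eq_bigr => i _.
    rewrite nth_rcons size_map size_iota ltn_ord (nth_map 0%N) ?size_iota //.
    by rewrite nth_iota // add1n -JE.
  move=> i; case: (ltnP i (d_ w)) => lti.
    by rewrite -(k0 (Ordinal lti)); congr k; apply: val_inj.
  by rewrite -[RHS]kd0; congr k; apply: val_inj => /=; have := ltn_ord i; lia.
- apply/span_subvP/allP; rewrite all_rcons all_map; apply/andP; split.
    exact: hw_sub_kw_mem.
  apply/allP => i; rewrite mem_iota add1n ltnS => ri.
  by have [o p lt] := bnd i ri ew; apply: Sform_mem => //; lia.
- rewrite size_rcons size_map size_iota.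
  have := dim_Uplus_le K m; rewrite -wE => /leq_trans -> //.
  by move: w0 ew; rewrite /d_; case: ifP; lia.
Qed.

End Basis.

Theorem theorem2p6 (R : realType) (w : nat) :
  (0 < w)%N -> ~~ odd w ->
  basis_of (Uplus R[i] w)
    (rcons [seq Sform R[i] w (four_pm1 w i) | i <- iota 1 (d_ w)]
           (hw_sub_kw R[i] w)).
Proof. exact: Uplus_basis. Qed.
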